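(* Let $X_{b4}$ be a smooth Küchle variety of type (b4). Then $X_{b4}$ is isomorphic to an intersection of a divisor of bidegree $(1,1)$ and a divisor of bidegree $(2,2)$ in $\mathbb{P}^3\times\mathbb{P}^3$.
   Context: We work over $\mathbb{C}$. $\mathrm{Gr}(2,6)$ is the Grassmannian of $2$-dimensional subspaces of $\mathbb{C}^6$, $\mathcal{U}$ is its tautological subbundle of rank $2$, and $\mathcal{O}(1)$ is the ample generator of its Picard group. A Küchle variety of type (b4) is a Fano fourfold of index 1 that is the zero locus of a global section of the vector bundle $S^2\mathcal{U}^\vee\oplus\mathcal{O}(2)$ on $\mathrm{Gr}(2,6)$ (of expected dimension $4$). *)

(* Defs.v *)
From HB Require Import structures.
From mathcomp Require Import all_boot all_order all_algebra.
From mathcomp Require Import complex mpoly reals.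

Set Implicit Arguments.
Unset Strict Implicit.
Unset Printing Implicit Defensive.

Import GRing.Theory Num.Theory.
Local Open Scope ring_scope.

Section Varieties.

Variable C : numClosedFieldType.

(* A classical variety presented by (multi)homogeneous coordinates:
   [crep v x] reads "v is a coordinate vector of the point x".  A point has
   many coordinate vectors, and not every vector represents a point. *)
Record space := Space {
  pt :> Type;
  ncoord : nat;
  crep : 'rV[C]_ncoord -> pt -> Prop }.

(* A subset of a variety, with the induced reduced structure. *)
Definition sub (X : space) (S : X -> Prop) : space :=
  @Space {x : X | S x} (ncoord X) (fun v x => crep v (sval x)).

Definition prod_space (X Y : space) : space :=
  @Space (X * Y)%type (ncoord X + ncoord Y)
    (fun v x => crep (lsubmx v) x.1 /\ crep (rsubmx v) x.2).

(* Coordinates of a subspace are the k * n entries of a matrix whose rows form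
   a basis of it. *)
Definition Gr (k n : nat) : space :=
  @Space {U : {vspace 'rV[C]_n} | \dim U = k} (k * n)
    (fun v U => <<[seq row i (vec_mx v) | i : 'I_k]>>%VS = sval U).

Definition Proj (n : nat) : space := Gr 1 n.+1.

(* The basic Zariski open sets; Q is an arbitrary polynomial, it need not be
   homogeneous or semi-invariant. *)
Definition basic_open (X : space) (Q : {mpoly C[ncoord X]}) (x : X) : Prop :=
  exists2 v, crep v x & Q.@[v 0] != 0.

Definition zopen (X : space) (U : X -> Prop) : Prop :=
  forall x, U x -> exists2 Q, basic_open Q x & forall y, basic_open Q y -> U y.

Definition regular_at (X : space) (f : X -> C) (x : X) : Prop :=
  exists P, exists2 Q : {mpoly C[ncoord X]}, basic_open Q x &
    forall y v, crep v y -> Q.@[v 0] != 0 -> f y = P.@[v 0] / Q.@[v 0].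

Definition morphism (X Y : space) (f : X -> Y) : Prop :=
  (forall V : Y -> Prop, zopen V -> zopen (fun x => V (f x))) /\
  (forall (g : Y -> C) x, regular_at g (f x) -> regular_at (fun x => g (f x)) x).

Definition isomorphic (X Y : space) : Prop :=
  exists (f : X -> Y) (g : Y -> X),
    [/\ morphism f, morphism g, cancel f g & cancel g f].

Definition irreducible (X : space) : Prop :=
  inhabited X /\
  forall U V : X -> Prop, zopen U -> zopen V ->
    (exists x, U x) -> (exists x, V x) -> exists x, U x /\ V x.

(* An isomorphism onto the image. *)
Definition immersion (X Y : space) (f : X -> Y) : Prop :=
  [/\ morphism f, injective f &
      exists2 g : sub (fun y => exists x, f x = y) -> X,
        morphism g & forall y, f (g y) = sval y].

(* Line bundles as cocycles: a local section on [dom i] is a function s i, and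
   on overlaps s i = tr i j * s j. *)
Record line_bundle (X : space) := LineBundle {
  idx : Type;
  dom : idx -> X -> Prop;
  tr : idx -> idx -> X -> C;
  dom_open : forall i, zopen (dom i);
  dom_cover : forall x, exists i, dom i x;
  tr_regular : forall i j x, dom i x -> dom j x -> regular_at (tr i j) x;
  tr_neq0 : forall i j x, dom i x -> dom j x -> tr i j x != 0;
  tr_cocycle : forall i j k x, dom i x -> dom j x -> dom k x ->
    tr i k x = tr i j x * tr j k x }.

(* M is isomorphic to the r-th tensor power of L. *)
Definition lb_iso_power (X : space) (M L : line_bundle X) (r : nat) : Prop :=
  exists h : idx M -> idx L -> X -> C,
    (forall i a x, dom i x -> dom a x -> regular_at (h i a) x /\ h i a x != 0) /\
    (forall i j a b x, dom i x -> dom j x -> dom a x -> dom b x ->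
       h i a x * tr a b x ^+ r = tr i j x * h j b x).

Definition lb_section (X : space) (L : line_bundle X) (s : idx L -> X -> C) : Prop :=
  (forall i x, dom i x -> regular_at (s i) x) /\
  (forall i j x, dom i x -> dom j x -> s i x = tr i j x * s j x).

(* The condition on f says f x = [s 0 x : ... : s N x]; since a coordinate
   vector of a point of P^N is nonzero, the s a have no common zero. *)
Definition very_ample (X : space) (L : line_bundle X) : Prop :=
  exists N (s : 'I_N.+1 -> idx L -> X -> C) (f : X -> Proj N),
    [/\ forall a, lb_section (s a), immersion f &
        forall i x, dom i x ->
          @crep (Proj N) (mxvec (\row_a s a i x)) (f x)].

Definition ample (X : space) (L : line_bundle X) : Prop :=
  exists k (M : line_bundle X), [/\ (0 < k)%N, lb_iso_power M L k & very_ample M].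

(* Derivations of the local ring at x; values of D on functions that are not
   regular at x are irrelevant. *)
Definition tangent_vector (X : space) (x : X) (D : (X -> C) -> C) : Prop :=
  [/\ forall f g U, zopen U -> U x -> (forall y, U y -> f y = g y) -> D f = D g,
      forall a f g, regular_at f x -> regular_at g x ->
        D (fun y => a * f y + g y) = a * D f + D g
    & forall f g, regular_at f x -> regular_at g x ->
        D (fun y => f y * g y) = D f * g x + f x * D g].

(* The anticanonical bundle of a smooth n-fold: with local coordinates z i on
   dom i and d(z i 1) ^ ... ^ d(z i n) = J i j * d(z j 1) ^ ... ^ d(z j n), the
   cocycle of the bundle of n-forms is (J i j)^-1, so that of its dual is J i j. *)
Definition anticanonical (n : nat) (X : space) (L : line_bundle X) : Prop :=
  exists z : idx L -> 'I_n -> X -> C,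
    [/\ forall i a x, dom i x -> regular_at (z i a) x,
        forall i x, dom i x -> exists2 D : 'I_n -> (X -> C) -> C,
          forall a, tangent_vector x (D a) & \det (\matrix_(a, b) D a (z i b)) != 0
      & forall i j x (D : 'I_n -> (X -> C) -> C), dom i x -> dom j x ->
          (forall a, tangent_vector x (D a)) ->
          \det (\matrix_(a, b) D a (z i b)) =
            tr i j x * \det (\matrix_(a, b) D a (z j b))].

(* For X smooth projective irreducible of dimension n: X is Fano, and r is the
   largest integer such that -K_X is divisible by r in Pic X. *)
Definition fano_of_index (n : nat) (X : space) (r : nat) : Prop :=
  exists K' : line_bundle X,
    [/\ anticanonical n K', ample K', exists H, lb_iso_power K' H r &
        forall H m, lb_iso_power K' H m -> (m <= r)%N].

(* The differential of p at v applied to w. *)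
Definition mdiff n (p : {mpoly C[n]}) (v w : 'rV[C]_n) : C :=
  \sum_(i < n) p^`M(i).@[v 0] * w 0 i.

(* A matrix A of full rank is a basis of a point of Gr(k,n).  The standard
   affine chart attached to the columns I is {A | colsub I A = 1}: an affine
   space mapped isomorphically onto an open subset of Gr(k,n). *)
Definition chart_poly k n (I : 'I_k -> 'I_n) (f : 'M[C]_(k, n) -> C)
    (p : {mpoly C[k * n]}) : Prop :=
  forall A, colsub I A = 1%:M -> f A = p.@[mxvec A 0].

Definition chart_regular k n (f : 'M[C]_(k, n) -> C) : Prop :=
  forall I, exists p, chart_poly I f p.

(* The derivative of f at A, within the chart I, in the direction B
   (where colsub I B = 0) is c. *)
Definition chart_deriv k n (I : 'I_k -> 'I_n) (f : 'M[C]_(k, n) -> C)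
    (A B : 'M[C]_(k, n)) (c : C) : Prop :=
  exists2 p, chart_poly I f p & c = mdiff p (mxvec A) (mxvec B).

(* Global sections of S^2 U^dual on Gr(k,n), U the tautological subbundle: a
   symmetric bilinear form on each subspace, s A being its Gram matrix in the
   basis formed by the rows of A. Values at A of smaller rank are irrelevant. *)
Definition S2Udual_section k n (s : 'M[C]_(k, n) -> 'M[C]_k) : Prop :=
  [/\ forall A, row_free A -> (s A)^T = s A,
      forall g A, g \in unitmx -> row_free A -> s (g *m A) = g *m s A *m g^T
    & forall i j, chart_regular (fun A => s A i j)].

(* Global sections of O(d) on Gr(k,n), O(1) being the determinant of U^dual. *)
Definition O_section (d : nat) k n (t : 'M[C]_(k, n) -> C) : Prop :=
  (forall g A, g \in unitmx -> row_free A -> t (g *m A) = \det g ^+ d * t A) /\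
  chart_regular t.

Section ZeroLocus.

Variables (k n : nat) (s : 'M[C]_(k, n) -> 'M[C]_k) (t : 'M[C]_(k, n) -> C).

Definition zero_locus (U : Gr k n) : Prop :=
  forall v, crep v U -> s (vec_mx v) = 0 /\ t (vec_mx v) = 0.

(* Jacobian criterion in the standard charts: the zero scheme of (s, t) is
   smooth, of codimension the rank of S^2 U^dual + O(d). *)
Definition smooth_zero_scheme : Prop :=
  forall (I : 'I_k -> 'I_n) A, colsub I A = 1%:M -> s A = 0 -> t A = 0 ->
  forall (S : 'M[C]_k) c, S^T = S ->
  exists B, [/\ colsub I B = 0,
                forall i j, chart_deriv I (fun A => s A i j) A B (S i j)
              & chart_deriv I t A B c].

End ZeroLocus.

(* The pair (s, t) is a global section of S^2 U^dual + O(2) on Gr(2,6) whose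
   zero locus is a smooth Fano fourfold of index 1. *)
Definition smooth_kuchle_b4 (s : 'M[C]_(2, 6) -> 'M[C]_2) (t : 'M[C]_(2, 6) -> C) :
    Prop :=
  [/\ S2Udual_section s, O_section 2 t, smooth_zero_scheme s t,
      irreducible (sub (zero_locus s t)) &
      fano_of_index 4 (sub (zero_locus s t)) 1].

Definition P3xP3 : space := prod_space (Proj 3) (Proj 3).

(* The equation of a divisor of bidegree (a, b). *)
Definition bidegree (a b : nat) (F : {mpoly C[ncoord P3xP3]}) : Prop :=
  F != 0 /\
  forall m, m \in msupp F ->
    (\sum_(i < ncoord (Proj 3)) m (lshift (ncoord (Proj 3)) i) = a)%N /\
    (\sum_(i < ncoord (Proj 3)) m (rshift (ncoord (Proj 3)) i) = b)%N.

Definition divisors_meet (F G : {mpoly C[ncoord P3xP3]}) (x : P3xP3) : Prop :=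
  forall v, crep v x -> F.@[v 0] = 0 /\ G.@[v 0] = 0.

(* Jacobian criterion in bihomogeneous coordinates: the scheme F = G = 0 is
   smooth of codimension 2.  Without it, an isomorphism with the reduced
   intersection says nothing about the scheme structure. *)
Definition smooth_intersection (F G : {mpoly C[ncoord P3xP3]}) : Prop :=
  forall x v, divisors_meet F G x -> crep v x ->
  forall c d, exists w, mdiff F v w = c /\ mdiff G v w = d.

End Varieties.

(* Main.v *)
(* The section of S^2 U^dual is a quadratic form Q on C^6, and t is a quadratic
   form in Pluecker coordinates.  On a plane through the kernel of Q the
   differential of A |-> A Q A^T is not onto, and if Q is degenerate some such
   plane lies in the zero locus; so smoothness makes Q nondegenerate.  For Q
   nondegenerate and <u, v> isotropic, the product of the Clifford
   multiplications by u and v on the half-spinors C^4 is a matrix y^T x of rank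
   one and trace zero, which determines u ^ v linearly.  Hence isotropic planes
   correspond to the points of the divisor x . y = 0 of P^3 x P^3, their Pluecker
   coordinates are bilinear in (x, y), and t becomes a form of bidegree (2, 2).
   First-order deformations of y^T x inside the matrices of rank one carry the
   Jacobian criterion from Gr(2, 6) over to P^3 x P^3. *)
Require Import Defs.
From HB Require Import structures.
From mathcomp Require Import all_boot all_order all_algebra.
From mathcomp Require Import complex mpoly reals.
From mathcomp Require Import boolp perm ring.
Set Implicit Arguments.
Unset Strict Implicit.
Unset Printing Implicit Defensive.
Import GRing.Theory Num.Theory.
Local Open Scope ring_scope.

(** * Half-spinors in dimension six *)

(** The sections are given only by equivariance and by polynomial expressions in charts, so that
    they come from quadratic forms has to be proved. This is done on pencils: on the planes spanned
    by u and a vector of a fixed line, a section becomes a function on P^1 with two polynomial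
    charts, and homogeneity bounds its degree. For S^2 U^dual the value on u thus does not depend on
    the plane; for O(2), t is quadratic in each vector, and invariance under v |-> v + c u makes it
    a form in u ^ v. The matrices reflect Spin(6) = SL(4): C^6 is Lambda^2 C^4, and x, y are pure
    spinors of two maximal isotropic subspaces of opposite families, whose intersection is the
    isotropic plane. No single polynomial formula for the two maps is used: spinors are read off
    from a row and a column of a rank-one matrix meeting at a nonzero entry, planes from two rows of
    a skew matrix. The maps are therefore handled as an incidence relation with local polynomial
    lifts. *)

Section Spin.
Variable R : comNzRingType.
Implicit Types (u v w : 'rV[R]_6) (x y z : 'rV[R]_4) (N : 'M[R]_4).

(* spin u and spin (star u) are the Clifford multiplications by u between the two
   half-spinor spaces of the hyperbolic form bil on 3 + 3 coordinates. *)
Definition spin_coef (c : nat -> R) (i j : nat) : R :=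
  match i, j with
  | 0, 1 => c 0%N | 0, 2 => c 1%N | 0, 3 => c 2%N
  | 1, 0 => - c 0%N | 2, 0 => - c 1%N | 3, 0 => - c 2%N
  | 1, 2 => - c 5%N | 1, 3 => c 4%N | 2, 3 => - c 3%N
  | 2, 1 => c 5%N | 3, 1 => - c 4%N | 3, 2 => c 3%N
  | _, _ => 0
  end.

Definition spin u : 'M[R]_4 :=
  \matrix_(i, j) spin_coef (fun k => u 0 (inord k)) i j.

(** Under C^6 = Lambda^2 C^4, [spin (star u)] is minus the Hodge dual of [spin u], and [bil u u] is
    minus twice the Pfaffian of [spin u]. *)
Definition star u : 'rV[R]_6 := \row_k u 0 (inord ((k + 3) %% 6)).

Definition bil u v : R := \sum_k u 0 k * star v 0 k.

Definition wedge n (u v : 'rV[R]_n) : 'M[R]_n := u^T *m v - v^T *m u.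

Lemma sum4 (F : 'I_4 -> R) :
  \sum_i F i = F (inord 0) + F (inord 1) + F (inord 2) + F (inord 3).
Proof.
rewrite !big_ord_recr big_ord0 /= add0r.
by congr (F _ + F _ + F _ + F _); apply/val_inj; rewrite /= inordK.
Qed.

Lemma sum6 (F : 'I_6 -> R) :
  \sum_i F i = F (inord 0) + F (inord 1) + F (inord 2) + F (inord 3)
             + F (inord 4) + F (inord 5).
Proof.
rewrite !big_ord_recr big_ord0 /= add0r.
by congr (F _ + F _ + F _ + F _ + F _ + F _); apply/val_inj; rewrite /= inordK.
Qed.

Lemma ord4P (P : 'I_4 -> Prop) :
  P (inord 0) -> P (inord 1) -> P (inord 2) -> P (inord 3) -> forall i, P i.
Proof.
by move=> h0 h1 h2 h3 [[|[|[|[|//]]]] h];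
  [move: h0|move: h1|move: h2|move: h3]; congr P; apply/val_inj; rewrite /= inordK.
Qed.

Lemma ord6P (P : 'I_6 -> Prop) :
  P (inord 0) -> P (inord 1) -> P (inord 2) -> P (inord 3) ->
  P (inord 4) -> P (inord 5) -> forall i, P i.
Proof.
by move=> h0 h1 h2 h3 h4 h5 [[|[|[|[|[|[|//]]]]]] h];
  [move: h0|move: h1|move: h2|move: h3|move: h4|move: h5];
  congr P; apply/val_inj; rewrite /= inordK.
Qed.

Lemma star_coef u k : (k < 6)%N -> star u 0 (inord k) = u 0 (inord ((k + 3) %% 6)).
Proof. by move=> hk; rewrite mxE inordK. Qed.

Lemma mulmx4E m p (A : 'M[R]_(m, 4)) (B : 'M[R]_(4, p)) i j :
  (A *m B) i j = A i (inord 0) * B (inord 0) j + A i (inord 1) * B (inord 1) j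
               + A i (inord 2) * B (inord 2) j + A i (inord 3) * B (inord 3) j.
Proof. by rewrite mxE sum4. Qed.

Lemma spinE u i j : spin u i j = spin_coef (fun k => u 0 (inord k)) i j.
Proof. by rewrite mxE. Qed.

Lemma starE u :
  (star u 0 (inord 0) = u 0 (inord 3)) * (star u 0 (inord 1) = u 0 (inord 4)) *
  (star u 0 (inord 2) = u 0 (inord 5)) * (star u 0 (inord 3) = u 0 (inord 0)) *
  (star u 0 (inord 4) = u 0 (inord 1)) * (star u 0 (inord 5) = u 0 (inord 2)).
Proof. by do !split; rewrite star_coef. Qed.

Lemma bilE u v : bil u v =
  u 0 (inord 0) * v 0 (inord 3) + u 0 (inord 1) * v 0 (inord 4)
  + u 0 (inord 2) * v 0 (inord 5) + u 0 (inord 3) * v 0 (inord 0)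
  + u 0 (inord 4) * v 0 (inord 1) + u 0 (inord 5) * v 0 (inord 2).
Proof. by rewrite /bil sum6 !starE. Qed.

Lemma starK : involutive star.
Proof. by move=> u; apply/rowP; elim/ord6P; rewrite !starE. Qed.

Lemma tr_spin u : (spin u)^T = - spin u.
Proof.
by apply/matrixP; elim/ord4P; elim/ord4P; rewrite !mxE !inordK //= ?oppr0 ?opprK.
Qed.

Lemma bilC u v : bil u v = bil v u.
Proof. rewrite !bilE; ring. Qed.

(** Polarised form of the identity that a skew 4 x 4 matrix times its Hodge dual is a scalar matrix,
    given by the Pfaffian. *)
Lemma clifford u v :
  spin u *m spin (star v) + spin v *m spin (star u) = - (bil u v)%:M.
Proof.
apply/matrixP => i j; rewrite bilE ![in RHS]mxE mxE !mulmx4E !spinE !inordK //.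
by move: i j; elim/ord4P; elim/ord4P; rewrite !inordK //= !starE -val_eqE /= !inordK //=; ring.
Qed.

Lemma deltaE n (a : 'I_n) k : (delta_mx 0 a : 'rV[R]_n) 0 k = (k == a)%:R.
Proof. by rewrite mxE eqxx. Qed.

Lemma mxtrace_spin u v : \tr (spin (star u) *m spin v) = - bil u v *+ 2.
Proof.
rewrite /mxtrace sum4 bilE !mulmx4E !spinE !inordK //= !starE; ring.
Qed.

(* The entries are - \tr (N *m spin e_a *m spin (star e_b)); by the trace formula
   for Clifford products this recovers wedge u v from spin (star u) *m spin v. *)
Definition plucker_coef N (a b : nat) : R :=
  let n i j := N (inord i) (inord j) in
  match a, b with
  | 0, 1 => - n 3%N 0%N | 1, 0 => n 3%N 0%N
  | 0, 2 => n 2%N 0%N | 2, 0 => - n 2%N 0%N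
  | 1, 2 => - n 1%N 0%N | 2, 1 => n 1%N 0%N
  | 0, 4 => n 2%N 1%N | 4, 0 => - n 2%N 1%N
  | 0, 5 => n 3%N 1%N | 5, 0 => - n 3%N 1%N
  | 1, 3 => n 1%N 2%N | 3, 1 => - n 1%N 2%N
  | 1, 5 => n 3%N 2%N | 5, 1 => - n 3%N 2%N
  | 2, 3 => n 1%N 3%N | 3, 2 => - n 1%N 3%N
  | 2, 4 => n 2%N 3%N | 4, 2 => - n 2%N 3%N
  | 3, 4 => n 0%N 3%N | 4, 3 => - n 0%N 3%N
  | 3, 5 => - n 0%N 2%N | 5, 3 => n 0%N 2%N
  | 4, 5 => n 0%N 1%N | 5, 4 => - n 0%N 1%N
  | 0, 3 => n 0%N 0%N + n 1%N 1%N | 3, 0 => n 2%N 2%N + n 3%N 3%N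
  | 1, 4 => n 0%N 0%N + n 2%N 2%N | 4, 1 => n 1%N 1%N + n 3%N 3%N
  | 2, 5 => n 0%N 0%N + n 3%N 3%N | 5, 2 => n 1%N 1%N + n 2%N 2%N
  | _, _ => 0
  end.

Definition plucker N : 'M[R]_6 := \matrix_(a, b) plucker_coef N a b.

Lemma pluckerE N a b : plucker N a b = plucker_coef N a b.
Proof. by rewrite mxE. Qed.

Lemma plucker_is_linear : linear plucker.
Proof.
move=> c N N'; apply/matrixP => a b; rewrite ![in RHS]mxE mxE.
by move: a b; elim/ord6P; elim/ord6P; rewrite !inordK //= ?mxE; ring.
Qed.

HB.instance Definition _ :=
  GRing.isLinear.Build R 'M[R]_4 'M[R]_6 _ plucker plucker_is_linear.

Lemma plucker_skew N : \tr N = 0 -> (plucker N)^T = - plucker N.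
Proof.
rewrite /mxtrace sum4 => N0; apply/matrixP => a b; apply/eqP; rewrite -subr_eq0 !mxE opprK; apply/eqP.
by move: a b; elim/ord6P; elim/ord6P; rewrite !inordK //=; (ring || (rewrite -[RHS]N0; ring)).
Qed.

Lemma spin_is_linear : linear spin.
Proof.
move=> c u v; apply/matrixP => i j; rewrite ![in RHS]mxE mxE.
by move: i j; elim/ord4P; elim/ord4P; rewrite !inordK //= ?mxE; ring.
Qed.

HB.instance Definition _ :=
  GRing.isLinear.Build R 'rV[R]_6 'M[R]_4 _ spin spin_is_linear.

Lemma star_is_linear : linear star.
Proof. by move=> c u v; apply/rowP => i; rewrite !mxE. Qed.

HB.instance Definition _ :=
  GRing.isLinear.Build R 'rV[R]_6 'rV[R]_6 _ star star_is_linear.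

(** The zero diagonal is a separate hypothesis because 2 need not be cancellable in [R]. *)
Lemma skew_spin (S : 'M[R]_4) : (forall i, S i i = 0) -> S^T = - S ->
  exists w, S = spin (star w).
Proof.
move=> Sd /matrixP Ss.
have sk i j : S j i = - S i j by have := Ss i j; rewrite !mxE.
exists (\row_(k < 6) nth 0 [:: - S (inord 2) (inord 3); S (inord 1) (inord 3);
  - S (inord 1) (inord 2); S (inord 0) (inord 1); S (inord 0) (inord 2); S (inord 0) (inord 3)] k).
apply/matrixP => i j; rewrite spinE.
by move: i j; elim/ord4P; elim/ord4P; rewrite !inordK //= ?Sd ?starE ?mxE ?inordK //=;
  rewrite ?opprK // sk.
Qed.

(** The subtracted term is the contribution of the scalar part of the Clifford product; it vanishes
    for orthogonal vectors. *)
Lemma plucker_spin u v a b :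
  plucker (spin (star u) *m spin v) a b
  = wedge u v a b - bil u v * bil (delta_mx 0 a) (delta_mx 0 b).
Proof.
have wE : wedge u v a b = u 0 a * v 0 b - v 0 a * u 0 b.
  by rewrite !mxE !big_ord1 !mxE.
rewrite pluckerE wE bilE.
by move: a b wE; elim/ord6P; elim/ord6P => _; rewrite !inordK //= ?mulmx4E ?spinE ?inordK //= ?starE;
  rewrite bilE ?deltaE -?val_eqE /= ?inordK //= ?mulr0n ?mulr1n; ring.
Qed.

Lemma spin_plucker x y a : (x *m y^T) 0 0 = 0 ->
  spin (row a (plucker (y^T *m x))) *m y^T = 0 /\
  spin (star (row a (plucker (y^T *m x)))) *m x^T = 0.
Proof.
have nE i j : (y^T *m x) i j = y 0 i * x 0 j by rewrite mxE big_ord1 mxE.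
have pE b : row a (plucker (y^T *m x)) 0 b = plucker_coef (y^T *m x) a b.
  by rewrite mxE pluckerE.
rewrite mulmx4E ![_^T _ _]mxE => xy0.
(* Every entry of the two products is the pairing of x and y times zero or a signed coordinate; the
   [exists] alternatives below try these multipliers in turn. *)
have E g : (exists c, g = (x 0 (inord 0) * y 0 (inord 0) + x 0 (inord 1) * y 0 (inord 1)
     + x 0 (inord 2) * y 0 (inord 2) + x 0 (inord 3) * y 0 (inord 3)) * c) -> g = 0.
  by case=> c ->; rewrite xy0 mul0r.
split; apply/colP => i; rewrite [RHS]mxE; apply: E.
  rewrite mulmx4E !spinE ![_^T _ _]mxE !inordK //.
  move: a i pE; elim/ord6P; elim/ord4P => pE; rewrite ?inordK //= ?starE ?pE ?inordK //= ?nE.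
  all: try solve [exists 0; ring | exists (y 0 (inord 0)); ring | exists (y 0 (inord 1)); ring
    | exists (y 0 (inord 2)); ring | exists (y 0 (inord 3)); ring
    | exists (- y 0 (inord 0)); ring | exists (- y 0 (inord 1)); ring
    | exists (- y 0 (inord 2)); ring | exists (- y 0 (inord 3)); ring].
rewrite mulmx4E !spinE ![_^T _ _]mxE !inordK //.
move: a i pE; elim/ord6P; elim/ord4P => pE; rewrite ?inordK //= ?starE ?pE ?inordK //= ?nE.
all: try solve [exists 0; ring | exists (x 0 (inord 0)); ring | exists (x 0 (inord 1)); ring
    | exists (x 0 (inord 2)); ring | exists (x 0 (inord 3)); ring
    | exists (- x 0 (inord 0)); ring | exists (- x 0 (inord 1)); ring
    | exists (- x 0 (inord 2)); ring | exists (- x 0 (inord 3)); ring].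
Qed.

End Spin.

Lemma plucker_eq0 (F : numFieldType) (N : 'M[F]_4) : \tr N = 0 -> plucker N = 0 -> N = 0.
Proof.
rewrite /mxtrace sum4 => N0 /matrixP p0.
have p k l : (k < 6)%N -> (l < 6)%N -> plucker_coef N k l = 0.
  by move=> hk hl; have := p0 (inord k) (inord l); rewrite pluckerE mxE !inordK.
have := (p 0 3 isT isT, p 1 4 isT isT, p 2 5 isT isT); rewrite /= => -[[h3 h4] h5].
(* The three vanishing diagonal sums minus the trace leave twice this entry. All other entries of
   [N] are, up to sign, entries of [plucker N] once this one is known to vanish. *)
have N00 : N (inord 0) (inord 0) = 0.
  apply/eqP; rewrite -[_ == 0](mulrn_eq0 _ 2) /=; apply/eqP.
  transitivity ((N (inord 0) (inord 0) + N (inord 1) (inord 1)) +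
   (N (inord 0) (inord 0) + N (inord 2) (inord 2)) + (N (inord 0) (inord 0) + N (inord 3) (inord 3))
    - (N (inord 0) (inord 0) + N (inord 1) (inord 1) + N (inord 2) (inord 2) + N (inord 3) (inord 3))).
    by ring.
  by rewrite N0 h3 h4 h5 !addr0 subr0.
move: h3 h4 h5; rewrite N00 !add0r => h3 h4 h5.
apply/matrixP; elim/ord4P; elim/ord4P; rewrite [RHS]mxE //.
- exact: (p 4 5 isT isT).
- exact: (p 5 3 isT isT).
- exact: (p 3 4 isT isT).
- exact: (p 2 1 isT isT).
- exact: (p 1 3 isT isT).
- exact: (p 2 3 isT isT).
- exact: (p 0 2 isT isT).
- exact: (p 0 4 isT isT).
- exact: (p 2 4 isT isT).
- exact: (p 1 0 isT isT).
- by apply/eqP; rewrite -oppr_eq0; apply/eqP; exact: (p 5 0 isT isT).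
- exact: (p 1 5 isT isT).
Qed.

Section Wedge.
Variables (F : fieldType) (n : nat).
Implicit Types u v w : 'rV[F]_n.

Lemma wedgeE u v a b : wedge u v a b = u 0 a * v 0 b - v 0 a * u 0 b.
Proof. by rewrite !mxE !big_ord1 !mxE. Qed.

Lemma wedge_lin u v (a b c d : F) :
  wedge (a *: u + b *: v) (c *: u + d *: v) = (a * d - b * c) *: wedge u v.
Proof. apply/matrixP => i j; rewrite !mxE !big_ord1 !mxE; ring. Qed.

Lemma wedge_eq0 u v : u != 0 -> wedge u v = 0 -> exists c, v = c *: u.
Proof.
move=> /rV0Pn[k uk] /matrixP w0; exists (v 0 k / u 0 k); apply/rowP => j.
have /eqP := w0 k j; rewrite wedgeE !mxE subr_eq0 => /eqP E.
by rewrite mulrAC -E mulrAC divff // mul1r.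
Qed.

End Wedge.

(** * Vectors incident to a pair of half-spinors *)

Section Incidence.
Variable F : numFieldType.
Implicit Types (u v w : 'rV[F]_6) (x y z : 'rV[F]_4).

(** For nonzero x and y, each of the two conditions cuts out a maximal isotropic subspace of C^6,
    one from each family. *)
Definition incident x y u : Prop :=
  spin u *m y^T = 0 /\ spin (star u) *m x^T = 0.

Lemma incident_lin x y (c : F) u v :
  incident x y u -> incident x y v -> incident x y (c *: u + v).
Proof.
move=> [u1 u2] [v1 v2]; rewrite /incident !linearP /= !mulmxDl -!scalemxAl.
by rewrite u1 u2 v1 v2 !scaler0 !addr0.
Qed.

(** If y and y' were independent, the skew matrix y ^ y' would be [spin (star w)] with w nonzero,
    and any z whose Clifford multiplication kills both would be a multiple of w. The independent
    vectors u and v cannot both be such. *)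
Lemma common_kernel u v y y' : wedge u v != 0 -> y != 0 ->
  spin u *m y^T = 0 -> spin v *m y^T = 0 ->
  spin u *m y'^T = 0 -> spin v *m y'^T = 0 -> exists c, y' = c *: y.
Proof.
move=> uv y0 uy vy uy' vy'; apply: wedge_eq0 => //.
have [] := @skew_spin _ (wedge y y').
- by move=> i; rewrite wedgeE mulrC subrr.
- by apply/matrixP => i j; rewrite [in RHS]mxE mxE !wedgeE; ring.
move=> w wE.
have K (z : 'rV_6) : spin z *m y^T = 0 -> spin z *m y'^T = 0 -> wedge w z = 0.
  move=> zy zy'.
  have N0 : spin (star w) *m spin z = 0.
    apply/eqP; rewrite -trmx_eq0 trmx_mul !tr_spin mulNmx mulmxN opprK -wE.
    by rewrite mulmxBr !mulmxA zy zy' !mul0mx subrr.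
  have b0 : bil w z = 0.
    apply/eqP; have /eqP := mxtrace_spin w z; rewrite N0 mxtrace0 eq_sym.
    by rewrite mulrn_eq0 oppr_eq0.
  apply/matrixP => a b; have := plucker_spin w z a b.
  by rewrite N0 linear0 b0 mul0r subr0 => <-; rewrite !mxE.
rewrite wE; have [-> | w0] := eqVneq w 0; first by rewrite !linear0.
have [c uE] := wedge_eq0 w0 (K _ uy uy').
have [d vE] := wedge_eq0 w0 (K _ vy vy').
case/eqP: uv; apply/matrixP => a b; rewrite wedgeE uE vE !mxE; ring.
Qed.

Lemma wedge_star u v : wedge u v != 0 -> wedge (star u) (star v) != 0.
Proof.
apply: contra_neq => w0; apply/matrixP => a b.
have st (w : 'rV[F]_6) c : w 0 c = star w 0 (inord ((c + 3) %% 6)).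
  by rewrite -{1}[w]starK mxE.
by rewrite wedgeE (st u a) (st v b) (st v a) (st u b) -wedgeE w0 !mxE.
Qed.

Definition isotropic_pair u v := [/\ bil u u = 0, bil u v = 0 & bil v v = 0].

Lemma spin_nil u : bil u u = 0 -> spin u *m spin (star u) = 0.
Proof.
move=> u0; have /eqP := clifford u u; rewrite u0 raddf0 oppr0 -mulr2n -scaler_nat.
by rewrite scaler_eq0 pnatr_eq0 => /eqP.
Qed.

Lemma spin_anticomm u v : bil u v = 0 ->
  spin u *m spin (star v) = - (spin v *m spin (star u)).
Proof.
by move=> uv0; apply/eqP; rewrite -addr_eq0 clifford uv0 raddf0 oppr0.
Qed.

Lemma bil_star u v : bil (star u) (star v) = bil u v.
Proof. rewrite !bilE !starE; ring. Qed.

Lemma spin_anticomm_star u v : bil u v = 0 ->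
  spin (star u) *m spin v = - (spin (star v) *m spin u).
Proof. by rewrite -bil_star => /spin_anticomm; rewrite !starK. Qed.

Lemma plucker_isotropic u v : bil u v = 0 ->
  plucker (spin (star u) *m spin v) = wedge u v.
Proof.
by move=> uv0; apply/matrixP => a b; rewrite plucker_spin uv0 mul0r subr0.
Qed.

Lemma bil_rank1 x y : (x *m y^T) 0 0 = \tr (y^T *m x).
Proof. by rewrite mxtrace_mulC /mxtrace big_ord1. Qed.

Lemma incident_wedge x y u v : x != 0 -> y != 0 -> wedge u v != 0 ->
  incident x y u -> incident x y v ->
  [/\ isotropic_pair u v, (x *m y^T) 0 0 = 0 &
      exists2 c, c != 0 & spin (star u) *m spin v = c *: (y^T *m x)
        /\ wedge u v = c *: plucker (y^T *m x)].
Proof.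
move=> x0 y0 uv [uy ux] [vy vx].
have bil0 (a b : 'rV_6) : spin a *m y^T = 0 -> spin b *m y^T = 0 -> bil a b = 0.
  move=> ay bY; have := clifford (star a) (star b); rewrite !starK bil_star => /(congr1 (mulmx^~ y^T)).
  rewrite mulmxDl -!mulmxA ay bY !mulmx0 addr0 mulNmx mul_scalar_mx => /esym/eqP.
  by rewrite oppr_eq0 scaler_eq0 trmx_eq0 (negbTE y0) orbF => /eqP.
have uu := bil0 _ _ uy uy; have uv0 := bil0 _ _ uy vy; have vv := bil0 _ _ vy vy.
set N := spin (star u) *m spin v.
have uN : spin u *m N = 0 by rewrite mulmxA spin_nil // mul0mx.
have vN : spin v *m N = 0.
  by rewrite /N spin_anticomm_star // mulmxN mulmxA spin_nil // mul0mx oppr0.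
have NT : N^T = spin v *m spin (star u).
  by rewrite trmx_mul !tr_spin mulNmx mulmxN opprK.
have uNT : spin (star u) *m N^T = 0.
  by rewrite NT mulmxA -/N /N spin_anticomm_star // mulNmx -mulmxA spin_nil // mulmx0 oppr0.
have vNT : spin (star v) *m N^T = 0.
  have := spin_nil (u := star v); rewrite starK bil_star => /(_ vv) vsv.
  by rewrite NT mulmxA vsv mul0mx.
have cj j : exists c, col j N = c *: y^T.
  have [] := @common_kernel u v y (col j N)^T uv y0 uy vy; rewrite ?trmxK.
  - by rewrite colE mulmxA uN mul0mx.
  - by rewrite colE mulmxA vN mul0mx.
  by move=> c /(congr1 trmx); rewrite trmxK linearZ /= => E; exists c.
have ri i : exists c, row i N = c *: x.
  have [] := @common_kernel _ _ x (row i N) (wedge_star uv) x0 ux vx.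
  - by rewrite tr_row colE mulmxA uNT mul0mx.
  - by rewrite tr_row colE mulmxA vNT mul0mx.
  by move=> c E; exists c.
have /rV0Pn[k xk] := x0; have /rV0Pn[l yl] := y0.
pose c := N l k / (y 0 l * x 0 k).
have NE : N = c *: (y^T *m x).
  apply/matrixP => i j; rewrite !mxE big_ord1 !mxE.
  have [d /rowP Ed] := ri i; have [e /colP Ee] := cj k.
  have := Ed j; have := Ed k; have := Ee i; have := Ee l; rewrite /c ![in X in X -> _]mxE => Elk Eik Eik' Eij.
  move: Elk Eik Eik' Eij; rewrite !mxE => -> -> E ->.
  have -> : d = e * y 0 i / x 0 k by rewrite E mulfK.
  by field; rewrite xk yl.
have c0 : c != 0.
  apply: contra_neq uv => c0; rewrite -plucker_isotropic // -/N NE c0 scale0r.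
  by rewrite linear0.
split => //.
- have := mxtrace_spin u v; rewrite -/N uv0 oppr0 mul0rn NE mxtraceZ -bil_rank1.
  by move/eqP; rewrite mulf_eq0 (negbTE c0) => /eqP.
- exists c => //; split=> //.
  by rewrite -plucker_isotropic // -/N NE linearZ.
Qed.
(** Converse construction: since the Clifford multiplications annihilate [N] and [N^T], any row and
    any column of [N] serve as the spinors. *)
Lemma incident_spinor u v k l : wedge u v != 0 -> isotropic_pair u v ->
  let N := spin (star u) *m spin v in
  incident (row k N) (col l N)^T u /\ incident (row k N) (col l N)^T v.
Proof.
move=> uv [uu uv0 vv] N.
have uN : spin u *m N = 0 by rewrite mulmxA spin_nil // mul0mx.
have vN : spin v *m N = 0.
  by rewrite /N spin_anticomm_star // mulmxN mulmxA spin_nil // mul0mx oppr0.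
have NT : N^T = spin v *m spin (star u).
  by rewrite trmx_mul !tr_spin mulNmx mulmxN opprK.
have uNT : spin (star u) *m N^T = 0.
  by rewrite NT mulmxA -/N /N spin_anticomm_star // mulNmx -mulmxA spin_nil // mulmx0 oppr0.
have vNT : spin (star v) *m N^T = 0.
  have := spin_nil (u := star v); rewrite starK bil_star => /(_ vv) vsv.
  by rewrite NT mulmxA vsv mul0mx.
by rewrite /incident !trmxK tr_row !colE !(mulmxA _ N) !(mulmxA _ N^T) uN vN uNT vNT !mul0mx.
Qed.

Lemma spinor_neq0 u v : wedge u v != 0 -> bil u v = 0 ->
  exists k l, (spin (star u) *m spin v) k l != 0.
Proof.
move=> uv uv0; apply/matrix0Pn; apply: contra_neq uv => N0.
by rewrite -plucker_isotropic // N0 linear0.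
Qed.

Lemma plucker_neq0 x y : x != 0 -> y != 0 -> (x *m y^T) 0 0 = 0 ->
  exists i j, plucker (y^T *m x) i j != 0.
Proof.
move=> /rV0Pn[k xk] /rV0Pn[l yl] xy0; apply/matrix0Pn.
apply: contraTneq (mulf_neq0 yl xk) => p0.
have /matrixP/(_ l k) : y^T *m x = 0 by apply: plucker_eq0; rewrite // -bil_rank1.
by rewrite !mxE big_ord1 !mxE => ->; rewrite eqxx.
Qed.

(** By skewness of [p], the minor of its rows i, j in the columns i, j is the square of [p i j].
    These rows give the plane a basis polynomial in x and y. *)
Lemma wedge_plucker_row x y i j : (x *m y^T) 0 0 = 0 ->
  let p := plucker (y^T *m x) in
  p i j != 0 -> wedge (row i p) (row j p) != 0.
Proof.
move=> xy0 p pij; apply/matrix0Pn; exists i, j.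
have /matrixP pT : p^T = - p by apply: plucker_skew; rewrite -bil_rank1.
have sk a b : p a b = - p b a by have := pT b a; rewrite !mxE.
have p0 a : p a a = 0.
  by apply/eqP; rewrite -[_ == 0](mulrn_eq0 _ 2) /= mulr2n {2}sk subrr.
have rE a b : row a p 0 b = p a b by rewrite mxE.
by rewrite wedgeE !rE p0 mul0r sub0r oppr_eq0 mulf_neq0 // sk oppr_eq0.
Qed.

(* First-order version of the fact that spin (star u) *m spin v has rank one:
   the tangent matrix N' satisfies spin u *m N' = - spin u' *m N, so it maps
   the kernel of x into the line of y. *)
Lemma spinor_tangent x y u v u' v' : x != 0 -> y != 0 -> wedge u v != 0 ->
  incident x y u -> incident x y v ->
  bil u u' = 0 -> bil v v' = 0 -> bil u' v + bil u v' = 0 ->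
  exists x' y', [/\ (x' *m y^T) 0 0 + (x *m y'^T) 0 0 = 0 &
    plucker (y'^T *m x + y^T *m x') = wedge u' v + wedge u v'].
Proof.
move=> x0 y0 uv iu iv uu' vv' uv'.
have [[uu uv0 vv] xy0 [c c0 [NE _]]] := incident_wedge x0 y0 uv iu iv.
have [[uy ux] [vy vx]] := (iu, iv).
pose N' := spin (star u') *m spin v + spin (star u) *m spin v'.
have antiD (a b : 'rV[F]_6) : spin a *m spin (star b) = - (bil a b)%:M - spin b *m spin (star a).
  by rewrite -clifford addrK.
have antiS (a b : 'rV[F]_6) : spin (star a) *m spin b = - (bil a b)%:M - spin (star b) *m spin a.
  by rewrite -bil_star -{1}[b]starK antiD starK.
have uN : spin u *m N' = - (spin u' *m (spin (star u) *m spin v)).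
  rewrite mulmxDr !mulmxA antiD uu' spin_nil // mul0mx addr0 raddf0 oppr0 sub0r.
  by rewrite mulNmx.
have N'E : N' = - (spin (star v) *m spin u') - spin (star v') *m spin u.
  by rewrite /N' (antiS u' v) (antiS u v') addrACA -opprD -raddfD /= uv' raddf0 oppr0 add0r.
have vN : spin v *m N' = - (spin v' *m (spin (star u) *m spin v)).
  rewrite N'E mulmxDr !mulmxN !mulmxA spin_nil // mul0mx oppr0 add0r (antiD v v') vv'.
  rewrite raddf0 oppr0 sub0r mulNmx opprK -!mulmxA (spin_anticomm_star (u := v)) 1?bilC //.
  by rewrite mulmxN.
have /rV0Pn[k xk] := x0; have /rV0Pn[l yl] := y0.
(* As [x *m xi] is 1, [T] projects onto the kernel of x, where [spin (star u) *m spin v] vanishes.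
   In N' = (N' xi) x + N' T the first summand supplies y', and the second, whose columns lie on the
   line of y, supplies x'. *)
pose xi : 'cV[F]_4 := (x 0 k)^-1 *: delta_mx k 0.
pose T : 'M[F]_4 := 1%:M - xi *m x.
have xT : x *m T = 0.
  rewrite mulmxBr mulmx1 mulmxA -scalemxAr -colE [col k x]mx11_scalar mxE.
  by rewrite scale_scalar_mx mulVf // mul1mx subrr.
have NT : spin (star u) *m spin v *m T = 0.
  by rewrite NE -scalemxAl -mulmxA xT mulmx0 scaler0.
have colT j : exists d, col j (N' *m T) = d *: y^T.
  have [] := @common_kernel u v y (col j (N' *m T))^T uv y0 uy vy; rewrite ?trmxK.
  - by rewrite colE !(mulmxA (spin u)) uN 2!mulNmx -(mulmxA (spin u')) NT mulmx0 mul0mx oppr0.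
  - by rewrite colE !(mulmxA (spin v)) vN 2!mulNmx -(mulmxA (spin v')) NT mulmx0 mul0mx oppr0.
  by move=> d /(congr1 trmx); rewrite trmxK linearZ /= => E; exists d.
pose x' : 'rV[F]_4 := (y 0 l)^-1 *: row l (N' *m T).
have TE : N' *m T = y^T *m x'.
  rewrite /x'; move: (N' *m T) colT => M colM.
  apply/matrixP => i j; have [d /colP Ed] := colM j.
  have ME a : M a j = d * y 0 a by have := Ed a; rewrite !mxE.
  by rewrite [RHS]mxE big_ord1 !mxE !ME; field.
have N'T : (N' *m xi)^T^T *m x + y^T *m x' = N'.
  by rewrite trmxK -TE mulmxBr mulmx1 mulmxA addrC subrK.
exists x', (N' *m xi)^T; split.
  rewrite bil_rank1 bil_rank1 -mxtraceD addrC N'T /N' mxtraceD !mxtrace_spin.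
  by rewrite -mulrnDl -opprD uv' oppr0 mul0rn.
rewrite N'T linearD /=; apply/matrixP => a b.
rewrite mxE !plucker_spin [RHS]mxE addrACA -opprD -mulrDl uv' mul0r oppr0 addr0 //.
Qed.

End Incidence.

(** * Polynomial functions and quadratic forms *)

Section Univariate.
Variable C : numFieldType.

Lemma poly_ext (p q : {poly C}) : (forall a : C, a != 0 -> p.[a] = q.[a]) -> p = q.
Proof.
move=> pq; apply/eqP; rewrite -subr_eq0; apply/negPn/negP => nz.
pose rs := [seq k.+1%:R : C | k <- iota 0 (size (p - q))].
have : (size rs < size (p - q)%R)%N.
  apply: max_poly_roots => //.
    apply/allP => _ /mapP[k _ ->].
    by rewrite rootE !hornerE pq ?subrr // pnatr_eq0.
  by rewrite map_inj_uniq ?iota_uniq // => k l /eqP; rewrite eqr_nat => /eqP[].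
by rewrite size_map size_iota ltnn.
Qed.

(** f and g are the expressions of a section of O(d) on P^1 in the two standard charts; the value at
    infinity is the coefficient of degree d. *)
Lemma poly_at_infinity (f g : {poly C}) d :
  (forall a : C, a != 0 -> f.[a] = a ^+ d * g.[a^-1]) ->
  (size f <= d.+1)%N /\ g.[0] = f`_d.
Proof.
move=> fg; set N := size g.
(* [h] is g with its coefficients reversed, so that a^N g(1/a) = h(a) and denominators disappear. *)
pose h := \poly_(i < N.+1) g`_(N - i).
have E : f * 'X^N = h * 'X^d.
  apply: poly_ext => a a0; rewrite !hornerE fg // -mulrA mulrC; congr (_ * _).
  rewrite horner_poly horner_coef -/N [RHS](reindex_inj rev_ord_inj) /=.
  rewrite big_ord_recr /= subSS subnn subn0 [g`_N]nth_default // mul0r addr0.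
  rewrite mulr_suml; apply: eq_bigr => i _; rewrite subSS subKn; last exact: ltnW.
  rewrite -mulrA; congr (_ * _).
  have -> : a ^+ N = a ^+ (N - i) * a ^+ i by rewrite -exprD subnK // ltnW.
  by rewrite exprVn mulrCA mulVf ?mulr1 // expf_neq0.
have cE k : (d <= k)%N -> f`_k = h`_(N + k - d).
  move=> dk; have := congr1 (fun p : {poly C} => p`_(N + k)) E.
  rewrite !coefMXn ltnNge leq_addr /= addKn ltnNge (leq_trans dk) ?leq_addl //.
split; last by rewrite cE // addnK coef_poly ltnSn subnn horner_coef0.
apply/leq_sizeP => k dk; rewrite cE ?(ltnW dk) // coef_poly ifF //.
by apply/negbTE; rewrite -leqNgt -addnBA ?(ltnW dk) // -addn1 leq_add2l subn_gt0.
Qed.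

Lemma horner_meval n (p : {mpoly C[n]}) (e : 'I_n -> {poly C}) :
  exists r : {poly C}, forall a, p.@[fun i => (e i).[a]] = r.[a].
Proof.
exists (\sum_(m <- msupp p) p@_m *: \prod_i e i ^+ m i) => a.
rewrite mevalE horner_sum; apply: eq_bigr => m _; rewrite hornerZ; congr (_ * _).
by rewrite horner_prod; apply: eq_bigr => i _; rewrite horner_exp.
Qed.

End Univariate.

Section QuadraticForms.
Variables (C : numFieldType) (n : nat).
Implicit Types (u v w z : 'rV[C]_n) (h : 'rV[C]_n -> C).

(** Only restrictions to spans of two vectors are accessible from charts, so nothing is required of
    the dependence of the coefficients on w and z. *)
Definition binary_quadratic h w z := exists c0 c1 c2, forall a b,
  h (a *: w + b *: z) = c0 * a ^+ 2 + c1 * (a * b) + c2 * b ^+ 2.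

Definition qform (Q : 'M[C]_n) u v : C := (u *m Q *m v^T) 0 0.

Lemma qform_sum Q u v : qform Q u v = \sum_i \sum_j u 0 i * Q i j * v 0 j.
Proof.
rewrite /qform mxE exchange_big /=; apply: eq_bigr => j _.
by rewrite !mxE mulr_suml; apply: eq_bigr => i _.
Qed.

Lemma qformDl Q u v w : qform Q (u + v) w = qform Q u w + qform Q v w.
Proof. by rewrite /qform !mulmxDl mxE. Qed.

Lemma qformDr Q u v w : qform Q w (u + v) = qform Q w u + qform Q w v.
Proof. by rewrite /qform raddfD /= mulmxDr mxE. Qed.

Lemma qformZl Q a u w : qform Q (a *: u) w = a * qform Q u w.
Proof. by rewrite /qform -!scalemxAl mxE. Qed.

Lemma qformZr Q a u w : qform Q w (a *: u) = a * qform Q w u.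
Proof. by rewrite /qform linearZ /= -scalemxAr mxE. Qed.

Lemma qformC Q u v : Q^T = Q -> qform Q u v = qform Q v u.
Proof.
move=> QT; rewrite /qform -[in LHS]QT -[u *m _]trmxK trmx_mul trmxK.
by rewrite -trmx_mul mxE mulmxA.
Qed.

(* Jordan-von Neumann: the parallelogram law makes the polarisation additive. *)
Lemma quadratic_of_binary h : (forall w z, binary_quadratic h w z) ->
  exists2 Q : 'M[C]_n, Q^T = Q & forall v, h v = qform Q v v.
Proof.
move=> hq; pose B u v := h (u + v) - h u - h v.
have h0 : h 0 = 0.
  have [c0 [c1 [c2 E]]] := hq 0 0; have := E 0 0.
  by rewrite !scale0r addr0 !expr0n !mulr0 !addr0.
have BZ a u v : B (a *: u) v = a * B u v.
  have [c0 [c1 [c2 E]]] := hq u v.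
  have := (E a 1, E a 0, E 0 1, (E 1 1, E 1 0)).
  rewrite /B !scale1r !scale0r !addr0 !add0r => -[[[-> ->] ->] [-> ->]]; ring.
have par u v : h (u + v) + h (u - v) = 2 * h u + 2 * h v.
  have [c0 [c1 [c2 E]]] := hq u v.
  have := (E 1 1, E 1 (-1), E 1 0, E 0 1).
  rewrite !scale1r !scale0r !addr0 !add0r !scaleN1r => -[[[-> ->] ->] ->]; ring.
have BC u v : B u v = B v u by rewrite /B [v + u]addrC -!addrA [- _ - _]addrC.
have BD u v w : B (u + v) w = B u w + B v w.
  have p1 := par (u + v) w; have p2 := par (u - w) v; have p3 := par u (v + w).
  have p4 := par u w.
  have e1 : u + v - w = u - w + v by rewrite addrAC.
  have e2 : u - (v + w) = u - w - v by rewrite opprD addrA addrAC.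
  have e3 : u + (v + w) = u + v + w by rewrite addrA.
  rewrite e1 in p1; rewrite e2 e3 in p3.
  have : 2 * h (u + v + w) = 2 * (h (u + v) + h (u + w) + h (v + w) - h u - h v - h w).
    transitivity ((h (u + v + w) + h (u - w + v)) - (h (u - w + v) + h (u - w - v))
      + (h (u - w - v) + h (u + v + w))); first by ring.
    rewrite p1 p2 [h (u - w - v) + _]addrC p3.
    have -> : h (u - w) = 2 * h u + 2 * h w - h (u + w) by rewrite -p4; ring.
    ring.
  move/(mulfI (_ : 2 != 0)); rewrite pnatr_eq0 => /(_ isT) E.
  by rewrite /B E; ring.
have B0 v : B 0 v = 0 by rewrite -(scale0r 0) BZ mul0r.
have Bsum (I : finType) (c : I -> C) (e : I -> 'rV[C]_n) v :
    B (\sum_i c i *: e i) v = \sum_i c i * B (e i) v.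
  by elim/big_rec2: _ => // i x y _ <-; rewrite BD BZ.
exists (\matrix_(i, j) (B (delta_mx 0 i) (delta_mx 0 j) / 2)).
  by apply/matrixP => i j; rewrite !mxE BC.
move=> v; have hB : h v = B v v / 2.
  have [c0 [c1 [c2 E]]] := hq v 0; have := (E 2 0, E 1 0).
  rewrite /B !scaler0 !addr0 scale1r scaler_nat mulr2n => -[-> ->].
  by field.
rewrite hB {1 2}[v]row_sum_delta Bsum qform_sum mulr_suml; apply: eq_bigr => i _.
rewrite BC Bsum mulr_sumr mulr_suml; apply: eq_bigr => j _.
by rewrite !mxE BC; ring.
Qed.

End QuadraticForms.

Section Biquadratic.
Variables (C : numFieldType) (n : nat).
Implicit Types (u v w z : 'rV[C]_n) (p : 'M[C]_n) (Q : 'I_n -> 'I_n -> 'M[C]_n).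

(* In coordinates, the sum of Q_ij(k, l) p_ki p'_lj: a bilinear form in the
   coordinates of p and p'. *)
Definition wedge_form Q p p' : C := \sum_i \sum_j (p^T *m Q i j *m p') i j.

(** Polarising in v at basis vectors expresses each coefficient [c ij u] by three values of h, hence
    as a quadratic form in u. *)
Lemma biquadratic_coefs (h : 'rV[C]_n -> 'rV[C]_n -> C) :
  (forall u w z, binary_quadratic (h u) w z) ->
  (forall v w z, binary_quadratic (h^~ v) w z) ->
  exists2 Q, forall i j, (Q i j)^T = Q i j &
    forall u v, h u v = \sum_i \sum_j qform (Q i j) u u * v 0 i * v 0 j.
Proof.
move=> hv hu.
pose c (ij : 'I_n * 'I_n) u :=
  (h u (delta_mx 0 ij.1 + delta_mx 0 ij.2) - h u (delta_mx 0 ij.1) - h u (delta_mx 0 ij.2)) / 2.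
have /fin_all_exists[Q QP] ij : exists P : 'M[C]_n, P^T = P /\ forall u, c ij u = qform P u u.
  have [| P PT PE] := @quadratic_of_binary _ n (c ij); last by exists P.
  move=> w z.
  have [a0 [a1 [a2 Ea]]] := hu (delta_mx 0 ij.1 + delta_mx 0 ij.2) w z.
  have [b0 [b1 [b2 Eb]]] := hu (delta_mx 0 ij.1) w z.
  have [d0 [d1 [d2 Ed]]] := hu (delta_mx 0 ij.2) w z.
  exists ((a0 - b0 - d0) / 2), ((a1 - b1 - d1) / 2), ((a2 - b2 - d2) / 2) => a b.
  rewrite /c Ea Eb Ed; ring.
exists (fun i j => Q (i, j)) => [i j | u v]; first by case: (QP (i, j)).
have [S ST SE] := quadratic_of_binary (hv u).
have cS ij : c ij u = S ij.1 ij.2.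
  have SD i j : qform S (delta_mx 0 i) (delta_mx 0 j) = S i j.
    by rewrite /qform -rowE trmx_delta -colE !mxE.
  rewrite /c !SE !qformDl !qformDr !SD.
  have -> : S ij.2 ij.1 = S ij.1 ij.2 by rewrite -[in LHS]ST mxE.
  by field.
rewrite SE qform_sum; apply: eq_bigr => i _; apply: eq_bigr => j _.
by case: (QP (i, j)) => _ <-; rewrite cS /=; ring.
Qed.

(* As with sectional curvatures: a biquadratic h invariant under unipotent
   transformations of (u, v) has, for its polarisation H, the relation
   H(u,v;u,v) + H(u,v;v,u) = - h u v, so that skew-symmetrising H gives 3 h. *)
Lemma quadratic_in_wedge (h : 'rV[C]_n -> 'rV[C]_n -> C) :
  (forall u w z, binary_quadratic (h u) w z) ->
  (forall u v, h u v = h v u) -> (forall c u v, h u (v + c *: u) = h u v) ->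
  exists2 Q, forall i j, (Q i j)^T = Q i j &
    forall u v, h u v = wedge_form Q (wedge u v) (wedge u v).
Proof.
move=> hv hC hT.
have hu v w z : binary_quadratic (h^~ v) w z.
  have [c0 [c1 [c2 E]]] := hv v w z.
  by exists c0, c1, c2 => a b; rewrite -E hC.
have [Q QT hQ] := biquadratic_coefs hv hu.
pose H u u' v v' := \sum_i \sum_j qform (Q i j) u u' * v 0 i * v' 0 j.
have HC u u' v v' : H u u' v v' = H u' u v v'.
  by apply: eq_bigr => i _; apply: eq_bigr => j _; rewrite qformC.
have HDl u u' w v v' : H (u + u') w v v' = H u w v v' + H u' w v v'.
  rewrite -big_split; apply: eq_bigr => i _; rewrite -big_split; apply: eq_bigr => j _.
  by rewrite qformDl !mulrDl.
have HDr u u' w v v' : H w (u + u') v v' = H w u v v' + H w u' v v'.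
  by rewrite HC HDl !(HC w).
have HNl u w v v' : H (- u) w v v' = - H u w v v'.
  rewrite -sumrN; apply: eq_bigr => i _; rewrite -sumrN; apply: eq_bigr => j _.
  by rewrite -scaleN1r qformZl !mulN1r !mulNr.
have HNr u w v v' : H w (- u) v v' = - H w u v v' by rewrite HC HNl HC.
have KDl u u' v v' w : H u u' (v + v') w = H u u' v w + H u u' v' w.
  rewrite -big_split; apply: eq_bigr => i _; rewrite -big_split; apply: eq_bigr => j _.
  by rewrite mxE mulrDr mulrDl.
have KDr u u' v v' w : H u u' w (v + v') = H u u' w v + H u u' w v'.
  rewrite -big_split; apply: eq_bigr => i _; rewrite -big_split; apply: eq_bigr => j _.
  by rewrite mxE mulrDr.
have KNl u u' v w : H u u' (- v) w = - H u u' v w.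
  rewrite -sumrN; apply: eq_bigr => i _; rewrite -sumrN; apply: eq_bigr => j _.
  by rewrite mxE mulrN mulNr.
have KNr u u' v w : H u u' w (- v) = - H u u' w v.
  rewrite -sumrN; apply: eq_bigr => i _; rewrite -sumrN; apply: eq_bigr => j _.
  by rewrite mxE mulrN.
have hH u v : h u v = H u u v v := hQ u v.
have two x : x *+ 2 = 0 -> x = 0 :> C.
  by move/eqP; rewrite mulrn_eq0 => /eqP.
(* This is the part of h u (v + c u) = h u v that is odd in c, extracted from c = 1 and c = -1. *)
have K u v : H u u u v + H u u v u = 0.
  have p := hT 1 u v; have m := hT (-1) u v.
  rewrite scale1r hH hH KDl !KDr in p; rewrite scaleN1r hH hH KDl !KDr !KNl !KNr in m.
  apply: two.
  transitivity (H u u v v + H u u v u + (H u u u v + H u u u u)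
    - (H u u v v - H u u v u + (- H u u u v - - H u u u u))); last by rewrite p m subrr.
  ring.
have hvv v : H v v v v = 0.
  by apply: two; rewrite mulr2n K.
(* Subtracting [K] at u - v from [K] at u + v isolates the terms of degree two in u and two in v. *)
have rel u v : H u v u v + H u v v u = - h u v.
  have p := K (u + v) v; have m := K (u - v) v.
  rewrite !HDl !HDr !KDl !KDr !(HC v u) !hvv in p.
  rewrite !HDl !HDr !HNl !HNr !KDl !KDr !KNl !KNr !(HC v u) !hvv in m.
  rewrite hH; apply/eqP; rewrite -subr_eq0 opprK; apply/eqP; apply: (two); apply: (two).
  by rewrite -[RHS](subrr 0) -[X in _ = X - _]p -[X in _ = _ - X]m; ring.
exists (fun i j => 3^-1 *: Q i j) => [i j | u v]; first by rewrite linearZ /= QT.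
have HE a b c d : H a b c d = \sum_i \sum_j (c^T *m (a *m Q i j *m b^T) *m d) i j.
  apply: eq_bigr => i _; apply: eq_bigr => j _; rewrite /qform.
  move: (a *m Q i j *m b^T) => X.
  by rewrite {2}[X]mx11_scalar mul_mx_scalar -scalemxAl !mxE big_ord1 !mxE mulrA.
have -> : wedge_form (fun i j => 3^-1 *: Q i j) (wedge u v) (wedge u v) =
    3^-1 * (H u u v v - H u v v u - (H v u u v - H v v u u)).
  rewrite !HE -!sumrB mulr_sumr; apply: eq_bigr => i _.
  rewrite -!sumrB mulr_sumr; apply: eq_bigr => j _.
  rewrite -scalemxAr -scalemxAl mxE; congr (_ * _).
  have sub_mx (A B : 'M[C]_n) : (A i j - B i j = (A - B) i j :> C) by rewrite !mxE.
  rewrite !sub_mx; congr (fun_of_matrix _ i j).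
  have -> : (wedge u v)^T = wedge v u.
    by apply/matrixP => k l; rewrite mxE !wedgeE; ring.
  rewrite /wedge mulmxBr !mulmxBl !mulmxA !opprB addrACA [RHS]addrACA.
  by congr (_ + _); rewrite addrC.
have := rel u v; rewrite (HC v u) -!hH (hC v u) => E.
have -> : H u v v u = - h u v - H u v u v by rewrite -E; ring.
by field.
Qed.

Lemma wedge_formDl Q p1 p2 p' :
  wedge_form Q (p1 + p2) p' = wedge_form Q p1 p' + wedge_form Q p2 p'.
Proof.
rewrite -big_split; apply: eq_bigr => i _; rewrite -big_split; apply: eq_bigr => j _ /=.
by rewrite linearD /= !mulmxDl mxE.
Qed.

Lemma wedge_formDr Q p p1 p2 :
  wedge_form Q p (p1 + p2) = wedge_form Q p p1 + wedge_form Q p p2.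
Proof.
rewrite -big_split; apply: eq_bigr => i _; rewrite -big_split; apply: eq_bigr => j _ /=.
by rewrite mulmxDr mxE.
Qed.

Lemma wedge_formZl Q c p p' : wedge_form Q (c *: p) p' = c * wedge_form Q p p'.
Proof.
rewrite mulr_sumr; apply: eq_bigr => i _; rewrite mulr_sumr; apply: eq_bigr => j _.
by rewrite linearZ /= -!scalemxAl mxE.
Qed.

Lemma wedge_formZr Q c p p' : wedge_form Q p (c *: p') = c * wedge_form Q p p'.
Proof.
rewrite mulr_sumr; apply: eq_bigr => i _; rewrite mulr_sumr; apply: eq_bigr => j _.
by rewrite -!scalemxAr mxE.
Qed.

End Biquadratic.

(** * Sections of S^2 U^dual and O(2) on Gr(2, n) *)

Lemma row_free_mull (F : fieldType) m n (g : 'M[F]_m) (A : 'M_(m, n)) :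
  g \in unitmx -> row_free (g *m A) = row_free A.
Proof. by move=> gu; rewrite /row_free eqmxMfull // row_full_unit. Qed.

Section Pairs.
Variables (F : fieldType) (n : nat).
Implicit Types u v w z : 'rV[F]_n.

Definition pairmx u v : 'M[F]_(2, n) := \matrix_(i < 2) (if i == 0 then u else v).

Definition mx2 (a b c d : F) : 'M[F]_2 :=
  \matrix_(i, j) (if i == 0 then if j == 0 then a else b
                  else if j == 0 then c else d).

Lemma row0_pairmx u v : row 0 (pairmx u v) = u.
Proof. by rewrite rowK. Qed.

Lemma row1_pairmx u v : row 1 (pairmx u v) = v.
Proof. by rewrite rowK. Qed.

Lemma ord2P (P : 'I_2 -> Prop) : P 0 -> P 1 -> forall i, P i.
Proof.
by move=> h0 h1 [[|[|//]] h]; [move: h0|move: h1]; congr P; apply/val_inj.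
Qed.

Lemma pairmx_rows (A : 'M[F]_(2, n)) : pairmx (row 0 A) (row 1 A) = A.
Proof. by apply/row_matrixP; elim/ord2P; rewrite rowK. Qed.

Lemma pairmxP u v (A : 'M[F]_(2, n)) : row 0 A = u -> row 1 A = v -> A = pairmx u v.
Proof. by move=> <- <-; rewrite pairmx_rows. Qed.

Lemma mx2_pairmx a b c d u v :
  mx2 a b c d *m pairmx u v = pairmx (a *: u + b *: v) (c *: u + d *: v).
Proof.
apply: pairmxP; apply/rowP => j; rewrite !mxE !big_ord_recl big_ord0 !mxE /=;
  by rewrite ?addr0.
Qed.

Lemma det_mx2 a b c d : \det (mx2 a b c d) = a * d - b * c.
Proof.
rewrite (expand_det_row _ 0) !big_ord_recl big_ord0 /cofactor !det_mx11 !mxE /=.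
rewrite /bump /= expr0 expr1 !mul1r; ring.
Qed.

Lemma mx2_unit a b c d : (mx2 a b c d \in unitmx) = (a * d - b * c != 0).
Proof. by rewrite unitmxE det_mx2 unitfE. Qed.

Lemma row_free_pairmx u v : row_free (pairmx u v) = (wedge u v != 0).
Proof.
apply/idP/idP => [fA | /matrix0Pn[i [j]]].
  apply/eqP => w0; have inj := row_free_inj fA.
  have [u0 | u0] := eqVneq u 0.
    have /inj/matrixP/(_ 0 0) : delta_mx (0 : 'I_1) 0 *m pairmx u v = 0 *m pairmx u v.
      by rewrite mul0mx -rowE row0_pairmx.
    by rewrite !mxE => /eqP; rewrite oner_eq0.
  have [c vE] := wedge_eq0 u0 w0.
  have /inj/matrixP/(_ 0 1) : row 1 (mx2 0 0 (- c) 1) *m pairmx u v = 0 *m pairmx u v.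
    by rewrite -row_mul mx2_pairmx row1_pairmx mul0mx vE scale1r scaleNr addNr.
  by rewrite !mxE => /eqP; rewrite oner_eq0.
rewrite wedgeE => ij; apply/row_freeP.
pose B : 'M[F]_(n, 2) := \matrix_(k, l) (if l == 0 then (k == i)%:R else (k == j)%:R).
have AB : pairmx u v *m B \in unitmx.
  suff -> : pairmx u v *m B = mx2 (u 0 i) (u 0 j) (v 0 i) (v 0 j).
    by rewrite mx2_unit [u 0 j * _]mulrC.
  apply/matrixP => a b; rewrite mxE.
  transitivity (\sum_(k | k == (if b == 0 then i else j)) pairmx u v a k).
    rewrite [RHS]big_mkcond; apply: eq_bigr => k _; rewrite [B k b]mxE.
    by case: (b == 0); case: eqP; rewrite ?mulr1 ?mulr0.
  by rewrite big_pred1_eq !mxE; move: a b; elim/ord2P; elim/ord2P.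
by exists (B *m invmx (pairmx u v *m B)); rewrite mulmxA mulmxV.
Qed.

Lemma wedge_neq0 u v i j : u 0 i * v 0 j - v 0 i * u 0 j != 0 -> wedge u v != 0.
Proof. by move=> ij; apply/matrix0Pn; exists i, j; rewrite wedgeE. Qed.

(* A reduced echelon basis, with pivots j and k, of a plane in the hyperplane i. *)
Definition normal_pair (i j k : 'I_n) w z :=
  [/\ w 0 i = 0, z 0 i = 0, w 0 j = 1, z 0 j = 0 & w 0 k = 0 /\ z 0 k = 1].

Hypothesis n_gt2 : (2 < n)%N.

Lemma third_index (i j : 'I_n) : exists2 k, k != i & k != j.
Proof.
have : ~~ ([set: 'I_n] \subset [set i; j]).
  apply: contraL n_gt2 => /subset_leq_card; rewrite cardsT card_ord cards2 -leqNgt => h.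
  by apply: leq_trans h _; case: (i != j).
by case/subsetPn => k _; rewrite !inE negb_or => /andP[]; exists k.
Qed.

(** The coefficient matrix need not be invertible: w and z may be dependent or zero, and a unit
    vector outside the used columns then completes the plane. *)
Lemma normal_pair_exists i w z : w 0 i = 0 -> z 0 i = 0 ->
  exists j k w' z' a b c d, [/\ normal_pair i j k w' z',
    w = a *: w' + b *: z' & z = c *: w' + d *: z'].
Proof.
have nz w1 z1 : w1 0 i = 0 -> z1 0 i = 0 -> w1 != 0 ->
    exists j k w' z' a b c d, [/\ normal_pair i j k w' z',
      w1 = a *: w' + b *: z' & z1 = c *: w' + d *: z'].
  move=> wi zi /rV0Pn[j wj].
  pose z2 := z1 - (z1 0 j / w1 0 j) *: w1.
  have z2j : z2 0 j = 0 by rewrite !mxE divfK // subrr.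
  have z2i : z2 0 i = 0 by rewrite !mxE wi zi mulr0 subr0.
  have z1E : z1 = z2 + (z1 0 j / w1 0 j) *: w1 by rewrite subrK.
  clearbody z2.
  have [k [e [z' [zE z'i z'j z'k]]]] : exists k e z', [/\ z2 = e *: z', z' 0 i = 0, z' 0 j = 0 & z' 0 k = 1].
    have [z20 | /rV0Pn[k zk]] := eqVneq z2 0.
      have [k ki kj] := third_index i j.
      exists k, 0, (delta_mx 0 k).
      by rewrite z20 scale0r !deltaE ![_ == k]eq_sym (negbTE ki) (negbTE kj) eqxx.
    exists k, (z2 0 k), ((z2 0 k)^-1 *: z2).
    by rewrite scalerA divff // scale1r !mxE z2i z2j !mulr0 mulVf.
  pose w' := (w1 0 j)^-1 *: w1 - (w1 0 k / w1 0 j) *: z'.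
  have w1E : w1 = w1 0 j *: w' + w1 0 k *: z'.
    by apply/rowP => l; rewrite !mxE; field.
  exists j, k, w', z', (w1 0 j), (w1 0 k), (z1 0 j), (e + z1 0 j / w1 0 j * w1 0 k).
  split => //.
    by split; rewrite // ?mxE ?wi ?z'i ?z'j ?z'k ?mulr0 ?subr0 ?mulVf //; split=> //; ring.
  by rewrite {1}z1E zE {2}w1E; apply/rowP => l; rewrite !mxE; field.
move=> wi zi; have [w0 | w0] := eqVneq w 0; last exact: nz.
have [z0 | z0] := eqVneq z 0; last first.
  have [j [k [w' [z' [a [b [c [d [N zE wE]]]]]]]]] := nz z w zi wi z0.
  by exists j, k, w', z', c, d, a, b.
have [j ji _] := third_index i i.
have [|||j' [k [w' [z' [a [b [c [d [N _ _]]]]]]]]] := nz (delta_mx 0 j) 0.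
- by rewrite deltaE eq_sym (negbTE ji).
- by rewrite mxE.
- by apply/rV0Pn; exists j; rewrite deltaE eqxx oner_eq0.
exists j', k, w', z', 0, 0, 0, 0.
by rewrite w0 z0 !scale0r addr0.
Qed.

End Pairs.

Section Sections.
Variables (C : numClosedFieldType) (n : nat).
Hypothesis n_gt2 : (2 < n)%N.
Implicit Types (u v w z : 'rV[C]_n).

Lemma chart_line k m (f : 'M[C]_(k, m) -> C) (I : 'I_k -> 'I_m)
    (E : 'M[{poly C}]_(k, m)) :
  chart_regular f -> (forall a, colsub I (map_mx (horner^~ a) E) = 1%:M) ->
  exists r : {poly C}, forall a, f (map_mx (horner^~ a) E) = r.[a].
Proof.
move=> /(_ I)[p pE] EI; have [r rE] := horner_meval p (fun l => mxvec E 0 l).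
exists r => a; rewrite pE ?EI // -rE; apply: meval_eq => l.
by case/mxvec_indexP: l => i j; rewrite !mxvecE mxE.
Qed.

(* Row operations bring pairmx u (w + a *: z) into the chart (i, j); the
   result depends polynomially on a. *)
Lemma regular_line (f : 'M[C]_(2, n) -> C) u i j w z : chart_regular f ->
  u 0 i != 0 -> w 0 i = 0 -> z 0 i = 0 -> w 0 j = 1 -> z 0 j = 0 ->
  exists r : {poly C}, forall a, f (pairmx ((u 0 i)^-1 *: (u - u 0 j *: (w + a *: z)))
                         (w + a *: z)) = r.[a].
Proof.
move=> fr ui wi zi wj zj.
pose E : 'M[{poly C}]_(2, n) := \matrix_(x, l)
  if x == 0 then ((u 0 i)^-1 * (u 0 l - u 0 j * w 0 l))%:P - ((u 0 i)^-1 * u 0 j * z 0 l)%:P * 'X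
  else (w 0 l)%:P + (z 0 l)%:P * 'X.
have EE a : map_mx (horner^~ a) E =
    pairmx ((u 0 i)^-1 *: (u - u 0 j *: (w + a *: z))) (w + a *: z).
  apply: pairmxP; apply/rowP => l; rewrite !mxE /= !hornerE; ring.
have [|r rE] := @chart_line _ _ f (fun x => if x == 0 then i else j) E fr.
  move=> a; rewrite EE; apply/matrixP.
  elim/ord2P; elim/ord2P; rewrite !mxE /= ?wi ?zi ?wj ?zj; by field.
by exists r => a; rewrite -EE.
Qed.

Lemma pairmx_line u i j w z a : u 0 i != 0 ->
  pairmx u (w + a *: z) =
  mx2 (u 0 i) (u 0 j) 0 1 *m
    pairmx ((u 0 i)^-1 *: (u - u 0 j *: (w + a *: z))) (w + a *: z).
Proof.
move=> ui; rewrite mx2_pairmx scalerA divff // !scale1r subrK scale0r add0r //.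
Qed.

(** The families w + a z and z + a w are the two affine charts of the line joining w and z, with z
    at infinity; [D] marks the vectors at which homogeneity is known. *)
Lemma homogeneous_binary (h : 'rV[C]_n -> C) (D : 'rV[C]_n -> bool) d w z (f g : {poly C}) :
  (forall a v, a != 0 -> D v -> h (a *: v) = a ^+ d * h v) ->
  (forall a, D (w + a *: z)) -> (forall a, D (z + a *: w)) ->
  (forall a, h (w + a *: z) = f.[a]) -> (forall a, h (z + a *: w) = g.[a]) ->
  (size f <= d.+1)%N /\ h z = f`_d.
Proof.
move=> hD Dw Dz hf hg; have [|sf g0] := @poly_at_infinity C f g d.
  move=> a a0; rewrite -hf -hg -hD ?Dz // scalerDr scalerA divff // scale1r addrC //.
by split=> //; rewrite -g0 -hg scale0r addr0.
Qed.

Lemma normal_pair_sym (i j k : 'I_n) w z : normal_pair i j k w z -> normal_pair i k j z w.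
Proof. by case=> ? ? ? ? []. Qed.

Lemma normal_pair_wedge u i j k w z a : normal_pair i j k w z -> u 0 i != 0 ->
  wedge u (w + a *: z) != 0.
Proof.
move=> [wi zi wj zj _] ui; apply: (@wedge_neq0 _ _ _ _ i j).
by rewrite !mxE wi zi wj zj !mulr0 !addr0 mulr1 mul0r subr0.
Qed.

Lemma wedgeDr u v c : wedge u (v + c *: u) = wedge u v.
Proof. by apply/matrixP => i j; rewrite !wedgeE !mxE; ring. Qed.

Lemma wedgeC u v : wedge u v = - wedge v u.
Proof. by apply/matrixP => i j; rewrite [in RHS]mxE !wedgeE; ring. Qed.

Lemma wedge0r u : wedge u 0 = 0.
Proof. by apply/matrixP => i j; rewrite wedgeE !mxE mulr0 mul0r subr0. Qed.

Section OSection.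
Variable t : 'M[C]_(2, n) -> C.
Hypothesis tO : O_section 2 t.

(** Extension by zero to dependent pairs lets homogeneity and invariance hold for all u and v. *)
Let tz u v := if wedge u v == 0 then 0 else t (pairmx u v).

Lemma O_section_mx2 a b c d u v : a * d - b * c != 0 ->
  tz (a *: u + b *: v) (c *: u + d *: v) = (a * d - b * c) ^+ 2 * tz u v.
Proof.
move=> g; rewrite /tz wedge_lin scaler_eq0 (negbTE g) /=.
have [_|uv] := eqVneq; first by rewrite mulr0.
by rewrite -mx2_pairmx tO.1 ?mx2_unit ?row_free_pairmx // det_mx2.
Qed.

Lemma O_sectionDr u v c : tz u (v + c *: u) = tz u v.
Proof.
have := @O_section_mx2 1 0 c 1 u v; rewrite !scale1r scale0r addr0 [v + _]addrC => -> //.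
  by rewrite mulr1 mul0r subr0 expr1n mul1r.
by rewrite mulr1 mul0r subr0 oner_eq0.
Qed.

Lemma O_sectionC u v : tz u v = tz v u.
Proof.
have := @O_section_mx2 0 1 1 0 v u.
rewrite !scale1r !scale0r addr0 add0r => -> //.
  by rewrite mulr0 mulr1 sub0r sqrrN expr1n mul1r.
by rewrite mulr0 mulr1 sub0r oppr_eq0 oner_eq0.
Qed.

Lemma O_sectionZr u v c : tz u (c *: v) = c ^+ 2 * tz u v.
Proof.
have [-> | c0] := eqVneq c 0.
  by rewrite scale0r expr0n mul0r /tz wedge0r eqxx.
have := @O_section_mx2 1 0 0 c u v; rewrite scale1r !scale0r addr0 add0r => -> //.
  by rewrite mulr0 subr0 mul1r.
by rewrite mulr0 subr0 mul1r.
Qed.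

(** For fixed u the function lives on C^n modulo u, so w and z may be moved into the hyperplane of a
    coordinate i with u_i nonzero. There, in a normal pair, each of the two families of planes stays
    in one chart, and homogeneity of degree 2 bounds the degree. *)
Lemma O_section_quadratic u w z : binary_quadratic (tz u) w z.
Proof.
have [-> | /rV0Pn[i ui]] := eqVneq u 0.
  by exists 0, 0, 0 => a b; rewrite /tz wedgeC wedge0r oppr0 eqxx !mul0r !addr0.
pose red v := v - (v 0 i / u 0 i) *: u.
have redi v : red v 0 i = 0 by rewrite !mxE divfK // subrr.
have [j [k [w' [z' [a1 [b1 [a2 [b2 [N wE zE]]]]]]]]] := normal_pair_exists n_gt2 (redi w) (redi z).
have [c0 [c1 [c2 E]]] : binary_quadratic (tz u) w' z'.
  have N' := normal_pair_sym N.
  have line w1 z1 j1 k1 : normal_pair i j1 k1 w1 z1 ->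
      exists r : {poly C}, forall a, tz u (w1 + a *: z1) = r.[a].
    move=> N1; have [wi zi wj zj _] := N1.
    have [r rE] := regular_line tO.2 ui wi zi wj zj.
    exists (u 0 i ^+ 2 *: r) => a; rewrite hornerZ -rE.
    have uw := normal_pair_wedge a N1 ui.
    rewrite /tz (negbTE uw) (pairmx_line j1 _ _ _ ui) tO.1 ?det_mx2 ?mulr1 ?mulr0 ?subr0 //.
      by rewrite mx2_unit mulr1 mulr0 subr0.
    by move: uw; rewrite -row_free_pairmx (pairmx_line j1 _ _ _ ui) row_free_mull ?mx2_unit ?mulr1 ?mulr0 ?subr0.
  have [f fE] := line _ _ _ _ N; have [g gE] := line _ _ _ _ N'.
  have [sf f2] := homogeneous_binary (D := xpredT) (fun a v _ _ => O_sectionZr u v a) (fun _ => isT) (fun _ => isT) fE gE.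
  exists f`_0, f`_1, f`_2 => a b.
  have [-> | a0] := eqVneq a 0.
    by rewrite scale0r add0r O_sectionZr f2; ring.
  have -> : a *: w' + b *: z' = a *: (w' + (b / a) *: z').
    by rewrite scalerDr scalerA mulrC divfK.
  rewrite O_sectionZr fE (horner_coef_wide _ sf) !big_ord_recl big_ord0 /= /bump /=; by field.
exists (c0 * a1 ^+ 2 + c1 * (a1 * b1) + c2 * b1 ^+ 2),
  (c0 * (a1 * a2) *+ 2 + c1 * (a1 * b2 + a2 * b1) + c2 * (b1 * b2) *+ 2),
  (c0 * a2 ^+ 2 + c1 * (a2 * b2) + c2 * b2 ^+ 2) => a b.
have -> : a *: w + b *: z = (a * a1 + b * a2) *: w' + (a * b1 + b * b2) *: z'
    + (a * (w 0 i / u 0 i) + b * (z 0 i / u 0 i)) *: u.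
  transitivity (a *: red w + b *: red z + (a * (w 0 i / u 0 i) + b * (z 0 i / u 0 i)) *: u).
    by apply/rowP => l; rewrite !mxE; ring.
  by rewrite wE zE; apply/rowP => l; rewrite !mxE; ring.
by rewrite O_sectionDr E; ring.
Qed.

Lemma O_section_form : exists2 Q, forall i j, (Q i j)^T = Q i j &
  forall u v, wedge u v != 0 -> t (pairmx u v) = wedge_form Q (wedge u v) (wedge u v).
Proof.
have [Q QT QE] := quadratic_in_wedge O_section_quadratic O_sectionC (fun c u v => O_sectionDr u v c).
by exists Q => // u v uv; rewrite -QE /tz (negbTE uv).
Qed.

End OSection.

Lemma mul_pairmx u v (Q : 'M[C]_n) :
  pairmx u v *m Q *m (pairmx u v)^T =
  mx2 (qform Q u u) (qform Q u v) (qform Q v u) (qform Q v v).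
Proof.
have QA i j : (pairmx u v *m Q *m (pairmx u v)^T) i j =
    qform Q (row i (pairmx u v)) (row j (pairmx u v)).
  rewrite /qform !mxE; apply: eq_bigr => l _; rewrite !mxE; congr (_ * _).
  by apply: eq_bigr => m _; rewrite !mxE.
by apply/matrixP; elim/ord2P; elim/ord2P; rewrite QA ?row0_pairmx ?row1_pairmx mxE.
Qed.

Section S2Section.
Variable s : 'M[C]_(2, n) -> 'M[C]_2.
Hypothesis sS : S2Udual_section s.

Lemma S2_section_sym u v : wedge u v != 0 ->
  s (pairmx u v) 1 0 = s (pairmx u v) 0 1.
Proof.
case: sS => sT _ _ uv; have /matrixP/(_ 0 1) : (s (pairmx u v))^T = s (pairmx u v).
  by apply: sT; rewrite row_free_pairmx.
by rewrite mxE.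
Qed.

Lemma S2_section_00 a b c d u v : wedge u v != 0 -> a * d - b * c != 0 ->
  s (pairmx (a *: u + b *: v) (c *: u + d *: v)) 0 0 =
  a ^+ 2 * s (pairmx u v) 0 0 + a * b * s (pairmx u v) 0 1 *+ 2
  + b ^+ 2 * s (pairmx u v) 1 1.
Proof.
case: sS => _ sM _ uv g; rewrite -mx2_pairmx sM ?mx2_unit ?row_free_pairmx //.
rewrite !mxE !big_ord_recl !big_ord0 !mxE !big_ord_recl !big_ord0 !mxE /=.
have -> : lift ord0 ord0 = 1 :> 'I_2 by apply/val_inj.
rewrite /= S2_section_sym //; ring.
Qed.

(** The value on u is a regular function on the projective space of planes through u; on every line
    it is homogeneous of degree 0, hence constant. *)
Lemma S2_section_const u v v' : wedge u v != 0 -> wedge u v' != 0 ->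
  s (pairmx u v) 0 0 = s (pairmx u v') 0 0.
Proof.
move=> uv uv'.
have /rV0Pn[i ui] : u != 0 by apply: contraNneq uv => ->; rewrite wedgeC wedge0r oppr0.
pose phi v := s (pairmx u v) 0 0.
have phiZ c w : c != 0 -> wedge u w != 0 -> phi (c *: w) = phi w.
  move=> c0 uw; have := @S2_section_00 1 0 0 c u w uw.
  rewrite scale1r !scale0r addr0 add0r mul1r mulr0 subr0 => /(_ c0).
  by rewrite /phi => ->; rewrite !mulr0 !mul0r mul0rn expr0n expr1n mul1r mul0r !addr0.
have phiD c w : wedge u w != 0 -> phi (w + c *: u) = phi w.
  move=> uw; have := @S2_section_00 1 0 c 1 u w uw.
  rewrite !scale1r !scale0r addr0 [w + _]addrC mul1r mul0r subr0 oner_eq0 => /(_ isT).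
  by rewrite /phi => ->; rewrite !mulr0 !mul0r mul0rn expr0n expr1n mul1r mul0r !addr0.
pose red v := v - (v 0 i / u 0 i) *: u.
have redK w : w = red w + (w 0 i / u 0 i) *: u by rewrite subrK.
have redi w : red w 0 i = 0 by rewrite !mxE divfK // subrr.
have [j [k [w' [z' [a1 [b1 [a2 [b2 [N wE zE]]]]]]]]] := normal_pair_exists n_gt2 (redi v) (redi v').
have [c phic] : exists c, forall a b, wedge u (a *: w' + b *: z') != 0 -> phi (a *: w' + b *: z') = c.
  have N' := normal_pair_sym N.
  have line w1 z1 j1 k1 : normal_pair i j1 k1 w1 z1 ->
      exists r : {poly C}, forall a, phi (w1 + a *: z1) = r.[a].
    move=> N1; have [wi zi wj zj _] := N1.
    have [r00 r00E] := regular_line (let: And3 _ _ h := sS in h 0 0) ui wi zi wj zj.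
    have [r01 r01E] := regular_line (let: And3 _ _ h := sS in h 0 1) ui wi zi wj zj.
    have [r11 r11E] := regular_line (let: And3 _ _ h := sS in h 1 1) ui wi zi wj zj.
    exists ((u 0 i ^+ 2) *: r00 + (u 0 i * u 0 j1) *: r01 *+ 2 + (u 0 j1 ^+ 2) *: r11) => a.
    rewrite !hornerE /= -r00E -r01E -r11E.
    have uw := normal_pair_wedge a N1 ui.
    have gU : mx2 (u 0 i) (u 0 j1) 0 1 \in unitmx by rewrite mx2_unit mulr1 mulr0 subr0.
    rewrite /phi (pairmx_line j1 _ _ _ ui) mx2_pairmx S2_section_00; first by ring.
      by rewrite -row_free_pairmx -(row_free_mull _ gU) -pairmx_line // row_free_pairmx.
    by rewrite mulr1 mulr0 subr0.
  have [f fE] := line _ _ _ _ N; have [g gE] := line _ _ _ _ N'.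
  have [|||sf f0] := @homogeneous_binary phi (fun v => wedge u v != 0) 0 w' z' f g _ _ _ fE gE.
  - by move=> a x a0 ux; rewrite phiZ // expr0 mul1r.
  - by move=> a; apply: normal_pair_wedge N ui.
  - by move=> a; apply: normal_pair_wedge N' ui.
  exists f`_0 => a b uab.
  have [a0 | a0] := eqVneq a 0.
    move: uab; rewrite a0 scale0r add0r => ub; rewrite phiZ //.
      by apply: contraNneq ub => ->; rewrite scale0r wedge0r.
    by have := normal_pair_wedge 0 N' ui; rewrite scale0r addr0.
  have E : a *: w' + b *: z' = a *: (w' + (b / a) *: z').
    by rewrite scalerDr scalerA mulrC divfK.
  rewrite E phiZ ?(normal_pair_wedge _ N) // fE (horner_coef_wide _ sf).
  by rewrite big_ord1 expr0 mulr1.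
have phiv w a b : wedge u w != 0 -> red w = a *: w' + b *: z' -> phi w = c.
  move=> uw wE'; rewrite (redK w) phiD; first by rewrite wE' phic // -wE'; move: uw; rewrite {1}(redK w) wedgeDr.
  by move: uw; rewrite {1}(redK w) wedgeDr.
by rewrite -!/(phi _) (phiv _ _ _ uv wE) (phiv _ _ _ uv' zE).
Qed.

(** [h u] is the common value on u of the Gram matrices of all planes through u. Two auxiliary
    vectors suffice to define it, since a nonzero u is independent of one of them. *)
Lemma S2_section_form : exists2 Q : 'M[C]_n, Q^T = Q &
  forall A, row_free A -> s A = A *m Q *m A^T.
Proof.
have [e0 [e1 e01]] : exists e0 e1 : 'rV[C]_n, forall u, u != 0 -> (wedge u e0 != 0) || (wedge u e1 != 0).
  have [k0 [k1 k01]] : exists k0 k1 : 'I_n, k0 != k1.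
    have k0 : 'I_n := Ordinal (ltn_trans (ltn0Sn 1) n_gt2).
    by have [k1 kk _] := third_index n_gt2 k0 k0; exists k1, k0.
  exists (delta_mx 0 k0), (delta_mx 0 k1) => u u0.
  rewrite -negb_and; apply/negP => /andP[/eqP w0 /eqP w1].
  have [a E0] := wedge_eq0 u0 w0; have [b E1] := wedge_eq0 u0 w1.
  move/rowP: E0 => E0; move/rowP: E1 => E1.
  have := (E0 k0, E0 k1, E1 k1).
  rewrite !mxE !eqxx [k1 == k0]eq_sym (negbTE k01) /= => -[[H0 H1] H2].
  have a0 : a != 0 by apply: contra_eq_neq H0 => ->; rewrite mul0r oner_eq0.
  have u1 : u 0 k1 = 0 by apply/eqP; move/esym/eqP: H1; rewrite mulf_eq0 (negbTE a0).
  by move: H2; rewrite u1 mulr0 => /eqP; rewrite oner_eq0.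
pose h u := if wedge u e0 != 0 then s (pairmx u e0) 0 0
            else if wedge u e1 != 0 then s (pairmx u e1) 0 0 else 0.
have hE u v : wedge u v != 0 -> h u = s (pairmx u v) 0 0.
  move=> uv; have u0 : u != 0 by apply: contraNneq uv => ->; rewrite wedgeC wedge0r oppr0.
  rewrite /h; have := e01 u u0.
  case: ifP => [w0 _| _ /= w1]; first exact: S2_section_const.
  by rewrite w1; exact: S2_section_const.
have h0 : h 0 = 0 by rewrite /h ![wedge 0 _]wedgeC !wedge0r oppr0 eqxx.
have hlin u v a b : wedge u v != 0 -> h (a *: u + b *: v) =
    a ^+ 2 * s (pairmx u v) 0 0 + a * b * s (pairmx u v) 0 1 *+ 2
    + b ^+ 2 * s (pairmx u v) 1 1.
  move=> uv; have [a0 | a0] := eqVneq a 0.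
    have [b0 | b0] := eqVneq b 0.
      by rewrite a0 b0 !scale0r addr0 h0 expr0n !mul0r mul0rn !addr0.
    have g : a * 0 - b * 1 != 0 by rewrite mulr0 mulr1 sub0r oppr_eq0.
    rewrite -(S2_section_00 uv g) -hE // wedge_lin scaler_eq0 (negbTE uv) orbF //.
  have g : a * 1 - b * 0 != 0 by rewrite mulr0 mulr1 subr0.
  by rewrite -(S2_section_00 uv g) -hE // wedge_lin scaler_eq0 (negbTE uv) orbF.
have hZ u c : h (c *: u) = c ^+ 2 * h u.
  have [-> | u0] := eqVneq u 0; first by rewrite scaler0 h0 mulr0.
  have [e ue] : exists e, wedge u e != 0.
    by case/orP: (e01 u u0); [exists e0 | exists e1].
  rewrite -[c *: u]addr0 -(scale0r e) hlin // (hE _ _ ue); ring.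
have [Q QT QE] : exists2 Q : 'M[C]_n, Q^T = Q & forall v, h v = qform Q v v.
  apply: quadratic_of_binary => w z.
  have [wz | wz] := eqVneq (wedge w z) 0; last first.
    exists (s (pairmx w z) 0 0), (s (pairmx w z) 0 1 *+ 2), (s (pairmx w z) 1 1) => a b.
    by rewrite hlin //; ring.
  have [-> | w0] := eqVneq w 0.
    by exists 0, 0, (h z) => a b; rewrite scaler0 add0r hZ; ring.
  have [c ->] := wedge_eq0 w0 wz.
  exists (h w), (h w * c *+ 2), (h w * c ^+ 2) => a b.
  by rewrite scalerA -scalerDl hZ; ring.
exists Q => // A fA; rewrite -(pairmx_rows A) in fA *; move: fA.
move: (row 0 A) (row 1 A) => u v; rewrite row_free_pairmx => uv.
have e10 := hlin u v 1 0 uv; have e01' := hlin u v 0 1 uv; have e11 := hlin u v 1 1 uv.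
rewrite !scale1r !scale0r !addr0 !add0r !QE !expr1n !expr0n /= in e10 e01' e11.
rewrite !qformDl !qformDr (qformC v u QT) in e11.
have E01 : s (pairmx u v) 0 1 = qform Q u v.
  suff /eqP : (s (pairmx u v) 0 1 - qform Q u v) *+ 2 = 0 by rewrite mulrn_eq0 subr_eq0 => /eqP.
  move/eqP: e11; rewrite eq_sym -subr_eq0 e10 e01' => /eqP <-; ring.
rewrite mul_pairmx; apply/matrixP; elim/ord2P; elim/ord2P; rewrite [RHS]mxE /=.
- by rewrite e10; ring.
- by [].
- by rewrite qformC // -E01 S2_section_sym.
- by rewrite e01'; ring.
Qed.

End S2Section.

End Sections.

(** * Smoothness forces nondegeneracy *)

(** Lagrange reduction: split off a vector of nonzero norm and pass to the Schur complement. *)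
Lemma symmetric_diagonal (F : numFieldType) n (Q : 'M[F]_n) : Q^T = Q ->
  exists2 P, P \in unitmx & exists d, P *m Q *m P^T = diag_mx d.
Proof.
elim: n Q => [|n IHn] Q QT.
  by exists 1%:M; [exact: unitmx1 | exists 0; apply/matrixP => -[]].
(* Sums of two basis vectors detect a nonzero form; i = j covers the basis vectors themselves, and 2
   is invertible. *)
have [Qz | [v Qv]] : (forall v, qform Q v v = 0) \/ exists v, qform Q v v != 0.
  have [/forallP h | /forallPn[[i j] h]] := boolP [forall ij : 'I_n.+1 * 'I_n.+1,
      (qform Q (delta_mx 0 ij.1 + delta_mx 0 ij.2) (delta_mx 0 ij.1 + delta_mx 0 ij.2) == 0)].
    left=> v; have h1 i : qform Q (delta_mx 0 i) (delta_mx 0 i) = 0.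
      have /eqP := h (i, i); rewrite /= -mulr2n -scaler_nat qformZl qformZr.
      by move/eqP; rewrite !mulf_eq0 !pnatr_eq0 /= => /eqP.
    have h2 i j : Q i j = 0.
      have /eqP := h (i, j); rewrite /= qformDl !qformDr !h1 addr0 add0r.
      rewrite (qformC (delta_mx 0 j) _ QT) -mulr2n => /eqP; rewrite mulrn_eq0 /= => /eqP.
      by rewrite /qform -rowE trmx_delta -colE !mxE.
    by rewrite qform_sum big1 // => i _; rewrite big1 // => j _; rewrite h2 mulr0 mul0r.
  by right; exists (delta_mx 0 i + delta_mx 0 j).
  exists 1%:M; first exact: unitmx1.
  have -> : Q = 0.
    apply/matrixP => i j; rewrite mxE; have := Qz (delta_mx 0 i + delta_mx 0 j).
    rewrite qformDl !qformDr !Qz addr0 add0r (qformC (delta_mx 0 j) _ QT) -mulr2n.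
    move/eqP; rewrite mulrn_eq0 /= => /eqP.
    by rewrite /qform -rowE trmx_delta -colE !mxE.
  by exists 0; rewrite mulmx0 mul0mx linear0.
have v0 : v != 0 by apply: contraNneq Qv => ->; rewrite /qform !mul0mx mxE.
(* [row_ebase v] is a basis whose first row is proportional to v. *)
pose P0 := row_ebase v; have P0u : P0 \in unitmx := row_ebase_unit v.
have [c vE] : exists c, v = c *: row 0 P0.
  have := mulmx_ebase v; rewrite rank_rV v0 -/P0 => <-.
  exists (col_ebase v 0 0); rewrite {1}[col_ebase v]mx11_scalar -mulmxA mul_scalar_mx.
  congr (_ *: _).
  rewrite rowE; congr (_ *m _); apply/rowP => j; rewrite !mxE eqxx /=.
  by case: j => [[|j] hj].
have [Q1 Q1def] : exists Q1 : 'M_(1 + n), Q1 = P0 *m Q *m P0^T by eexists.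
have Q1T : Q1^T = Q1 by rewrite Q1def !trmx_mul trmxK QT mulmxA.
set a := Q1 0 0.
have a0 : a != 0.
  apply: contraNneq Qv => a0; rewrite vE qformZl qformZr.
  suff -> : qform Q (row 0 P0) (row 0 P0) = a by rewrite a0 !mulr0.
  rewrite /qform /a Q1def !mxE; apply: eq_bigr => l _; rewrite !mxE; congr (_ * _).
  by apply: eq_bigr => m _; rewrite !mxE.
pose b := ursubmx Q1; pose D := drsubmx Q1.
have Q1E : Q1 = block_mx a%:M b b^T D.
  rewrite -[LHS]submxK; congr block_mx.
    by rewrite [LHS]mx11_scalar mxE [usubmx _ _ _]mxE; congr (Q1 _ _)%:M; apply/val_inj.
  by rewrite -[in LHS]Q1T trmx_ursub.
have DT : D^T = D by rewrite trmx_drsub Q1T.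
have [|P2 P2u [d P2E]] := IHn (D - a^-1 *: (b^T *m b)).
  by rewrite linearB linearZ /= trmx_mul trmxK DT.
pose L : 'M_(1 + n) := block_mx 1%:M 0 (- a^-1 *: (P2 *m b^T)) P2.
have Lu : L \in unitmx by rewrite unitmxE /L det_lblock det1 mul1r -unitmxE.
have LE : L *m Q1 *m L^T = diag_mx (row_mx a%:M d).
  rewrite Q1E /L tr_block_mx !mulmx_block.
  rewrite trmx1 trmx0 !(mul0mx, mulmx0, mul1mx, mulmx1, addr0, add0r).
  have e0 : - a^-1 *: (P2 *m b^T) *m a%:M + P2 *m b^T = 0.
    by rewrite mul_mx_scalar scalerA mulrN divff // scaleN1r addNr.
  rewrite e0 mul0mx add0r diag_mx_row; congr block_mx.
  - by apply/matrixP => i j; rewrite !mxE !ord1 eqxx mulr1n.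
  - apply/eqP; rewrite -trmx_eq0 linearD /= !trmx_mul !trmxK tr_scalar_mx.
    by rewrite e0.
  - by rewrite -P2E mulmxBr -scalemxAr -scalemxAl mulmxA scaleNr addrC.
exists (L *m P0); first by rewrite unitmx_mul Lu.
exists (row_mx a%:M d); rewrite -LE trmx_mul Q1def !mulmxA //.
Qed.

(** * Derivatives as linear coefficients along lines *)

Section Derivatives.
Variable C : numClosedFieldType.

Lemma mdiff_line n (p : {mpoly C[n]}) (v w : 'rV[C]_n) :
  exists2 r : {poly C}, forall a, p.@[(v + a *: w) 0] = r.[a] & mdiff p v w = r`_1.
Proof.
pose P (p : {mpoly C[n]}) := exists2 r : {poly C},
  forall a, p.@[(v + a *: w) 0] = r.[a] & mdiff p v w = r`_1.
have PC c : P c%:MP.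
  exists c%:P => [a|]; first by rewrite mevalC hornerC.
  by rewrite coefC /mdiff big1 // => i _; rewrite mderivC meval0 mul0r.
have PX i : P 'X_i.
  exists ((v 0 i)%:P + (w 0 i)%:P * 'X) => [a|].
    by rewrite mevalXU !mxE !hornerE mulrC.
  rewrite coefD coefC coefMX coefC add0r /mdiff (bigD1 i) //= big1 ?addr0.
    by rewrite mderivX mnm1E eqxx scale1r mevalX big1 ?mul1r // => j _; rewrite mnmBE subnn expr0.
  by move=> j /negbTE ji; rewrite mderivX mnm1E eq_sym ji scale0r meval0 mul0r.
have PD q1 q2 : P q1 -> P q2 -> P (q1 + q2).
  move=> [r1 h1 d1] [r2 h2 d2]; exists (r1 + r2) => [a|].
    by rewrite mevalD h1 h2 hornerD.
  rewrite coefD -d1 -d2 -big_split; apply: eq_bigr => i _ /=.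
  by rewrite mderivD mevalD mulrDl.
have PM q1 q2 : P q1 -> P q2 -> P (q1 * q2).
  move=> [r1 h1 d1] [r2 h2 d2]; exists (r1 * r2) => [a|].
    by rewrite mevalM h1 h2 hornerM.
  rewrite coefM big_ord_recl big_ord1 /= /bump /= -d1 -d2.
  have /esym := h1 0; rewrite scale0r addr0 horner_coef0 => ->.
  have /esym := h2 0; rewrite scale0r addr0 horner_coef0 => ->.
  rewrite mulr_sumr mulr_suml -big_split; apply: eq_bigr => i _ /=.
  rewrite mderivM mevalD !mevalM; ring.
have PXm m : P 'X_[m].
  rewrite mpolyXE_id; elim/big_ind: _ => [| |i _]; [exact: (PC 1) | exact: PM |].
  by elim: (m i) => [|k IH]; [exact: (PC 1) | rewrite exprS; apply: PM].
elim/mpolyind: p => [|c m p _ _ Pp]; first exact: (PC 0).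
by apply: PD => //; rewrite -mul_mpolyC; apply: PM.
Qed.

Lemma mdiff0 n (v w : 'rV[C]_n) : mdiff 0 v w = 0.
Proof. by rewrite /mdiff big1 // => i _; rewrite mderiv0 meval0 mul0r. Qed.

Lemma mdiff_eq n (p : {mpoly C[n]}) (v w : 'rV[C]_n) (r : {poly C}) :
  (forall a, p.@[(v + a *: w) 0] = r.[a]) -> mdiff p v w = r`_1.
Proof.
move=> pr; have [r' pr' ->] := mdiff_line p v w.
by have -> : r' = r by apply: poly_ext => a _; rewrite -pr -pr'.
Qed.

End Derivatives.

Section Charts.
Variable C : numClosedFieldType.

Lemma chart_row_free k n (I : 'I_k -> 'I_n) (A : 'M[C]_(k, n)) :
  colsub I A = 1%:M -> row_free A.
Proof.
move=> AI; apply/row_freeP; exists (colsub I 1%:M).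
by rewrite mulmx_colsub mulmx1.
Qed.

Lemma chart_line_row_free k n (I : 'I_k -> 'I_n) (A B : 'M[C]_(k, n)) a :
  colsub I A = 1%:M -> colsub I B = 0 -> row_free (A + a *: B).
Proof.
move=> AI BI; apply: (@chart_row_free _ _ I); apply/matrixP => i j.
move/matrixP/(_ i j): AI => <-; move/matrixP/(_ i j): BI.
by rewrite !mxE => ->; rewrite mulr0 addr0.
Qed.

(** [chart_deriv] leaves the chart polynomial unspecified; its differential is nevertheless
    determined, because the line A + a B stays in the chart. *)
Lemma chart_deriv_eq k n (I : 'I_k -> 'I_n) f (A B : 'M[C]_(k, n)) c (r : {poly C}) :
  colsub I A = 1%:M -> colsub I B = 0 -> chart_deriv I f A B c ->
  (forall a, f (A + a *: B) = r.[a]) -> c = r`_1.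
Proof.
move=> AI BI [p pf ->] fr; apply: mdiff_eq => a.
rewrite -linearZ -linearD /= -pf ?fr //; apply/matrixP => i j.
move/matrixP/(_ i j): AI => <-; move/matrixP/(_ i j): BI.
by rewrite !mxE => ->; rewrite mulr0 addr0.
Qed.

Lemma chart_exists k n (A : 'M[C]_(k, n)) : row_free A ->
  exists g (I : 'I_k -> 'I_n), g \in unitmx /\ colsub I (g *m A) = 1%:M.
Proof.
move=> fA; have fA' : row_full A^T by rewrite /row_full mxrank_tr.
pose I := fullrankfun fA'.
have uI : colsub I A \in unitmx.
  have -> : colsub I A = (rowsub I A^T)^T by apply/matrixP => i j; rewrite !mxE.
  by rewrite unitmx_tr; exact: fullrowsub_unit.
exists (invmx (colsub I A)), I; split; first by rewrite unitmx_inv.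
by rewrite -mulmx_colsub mulVmx.
Qed.

End Charts.

Section Nondegenerate.
Variable C : numClosedFieldType.

Lemma binary_root (c0 c1 c2 : C) : exists a b,
  (a != 0) || (b != 0) /\ c0 * a ^+ 2 + c1 * (a * b) + c2 * b ^+ 2 = 0.
Proof.
have [-> | n0] := eqVneq c0 0.
  by exists 1, 0; rewrite oner_eq0; split=> //; ring.
pose r := sqrtC (c1 ^+ 2 - 4 * c0 * c2).
exists (r - c1), (2 * c0); rewrite mulf_neq0 ?pnatr_eq0 ?orbT //; split=> //.
transitivity (c0 * (r ^+ 2 - (c1 ^+ 2 - 4 * c0 * c2))); first by ring.
by rewrite sqrtCK subrr mulr0.
Qed.

Lemma qform_diag m n (P : 'M[C]_(m, n)) Q d u v : P *m Q *m P^T = diag_mx d ->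
  qform Q (u *m P) (v *m P) = \sum_i d 0 i * u 0 i * v 0 i.
Proof.
move=> PQ; have -> : qform Q (u *m P) (v *m P) = qform (diag_mx d) u v.
  by rewrite /qform -PQ trmx_mul !mulmxA.
rewrite qform_sum; apply: eq_bigr => i _; rewrite (bigD1 i) //= big1 => [|j ji].
  by rewrite mxE eqxx mulr1n addr0; ring.
by rewrite mxE eq_sym (negbTE ji) mulr0n mulr0 mul0r.
Qed.

Lemma S2_chart_deriv n (Q : 'M[C]_n) (s : 'M[C]_(2, n) -> 'M[C]_2) I A B (S : 'M_2) :
  (forall A, row_free A -> s A = A *m Q *m A^T) ->
  colsub I A = 1%:M -> colsub I B = 0 ->
  (forall i j, chart_deriv I (fun A => s A i j) A B (S i j)) ->
  S = A *m Q *m B^T + B *m Q *m A^T.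
Proof.
move=> sQ AI BI sB; apply/matrixP => i j.
pose r : {poly C} := ((A *m Q *m A^T) i j)%:P +
  ((A *m Q *m B^T + B *m Q *m A^T) i j)%:P * 'X + ((B *m Q *m B^T) i j)%:P * 'X^2.
have -> : (A *m Q *m B^T + B *m Q *m A^T) i j = r`_1.
  by rewrite !coefD coefC coefMX coefC coefMXn add0r addr0.
apply: (chart_deriv_eq AI BI (sB i j)) => a.
rewrite sQ ?(chart_line_row_free _ AI BI) // !hornerE.
rewrite linearD linearZ /= !mulmxDl !mulmxDr -!scalemxAl -!scalemxAr.
by move: (A *m Q *m A^T) (A *m Q *m B^T) (B *m Q *m A^T) (B *m Q *m B^T) => X Y Z W;
  rewrite !mxE; ring.
Qed.

(* If v spans a kernel line of Q, the Gram matrix of a plane through v cannot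
   vary to first order in the entry v, v; such a plane exists in the zero locus
   because v^perp / v contains a line, on which t is a binary quadratic form. *)
Lemma smooth_nondegenerate n (Q : 'M[C]_n) (s : 'M[C]_(2, n) -> 'M[C]_2) t :
  (4 < n)%N -> Q^T = Q -> (forall A, row_free A -> s A = A *m Q *m A^T) ->
  O_section 2 t -> smooth_zero_scheme s t -> Q \in unitmx.
Proof.
move=> n4 QT sQ tO sm; have n2 : (2 < n)%N by apply: leq_trans n4.
have [P Pu [d PQ]] := symmetric_diagonal QT.
suff dn i : d 0 i != 0.
  have : diag_mx d \in unitmx.
    by rewrite unitmxE det_diag unitfE; apply/prodf_neq0 => i _; exact: dn.
  by rewrite -PQ !unitmx_mul => /andP[/andP[]].
apply/negP => /eqP di.
(* Five diagonal coordinates are used: the degenerate one, moved to place 0, and two pairs, each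
   containing an isotropic vector. These, [w1] and [w2], are orthogonal, so all their combinations
   are isotropic, and one combination makes t vanish. *)
pose g (k : 'I_5) := tperm (Ordinal (ltn_trans (ltn0Sn 3) n4)) i (widen_ord n4 k).
have gI : injective g by move=> k l /perm_inj/(congr1 val) /= /val_inj.
have g0 : g ord0 = i.
  by rewrite /g (_ : widen_ord _ _ = Ordinal (ltn_trans (ltn0Sn 3) n4)) ?tpermL //; apply/val_inj.
pose P5 : 'M_(5, n) := rowsub g P.
have P5free : row_free P5.
  have -> : P5 = rowsub g 1%:M *m P by rewrite mul_rowsub_mx mul1mx.
  rewrite /row_free mxrankMfree ?row_free_unit //; apply/row_freeP; exists (colsub g 1%:M).
  rewrite mulmx_colsub mulmx1; apply/matrixP => k l; rewrite !mxE.
  by rewrite (inj_eq gI).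
have P5Q : P5 *m Q *m P5^T = diag_mx (\row_k d 0 (g k)).
  apply/matrixP => k l; transitivity ((P *m Q *m P^T) (g k) (g l)).
    rewrite !mxE; apply: eq_bigr => m _; rewrite !mxE; congr (_ * _).
    by apply: eq_bigr => m' _; rewrite !mxE.
  by rewrite PQ !mxE (inj_eq gI).
pose d' (k : nat) := d 0 (g (inord k)).
have [a1 [b1 [nz1 r1]]] := binary_root (d' 1%N) 0 (d' 2).
have [a2 [b2 [nz2 r2]]] := binary_root (d' 3) 0 (d' 4).
pose v0 : 'rV[C]_5 := \row_k [:: 1; 0; 0; 0; 0]`_k.
pose w1 : 'rV[C]_5 := \row_k [:: 0; a1; b1; 0; 0]`_k.
pose w2 : 'rV[C]_5 := \row_k [:: 0; 0; 0; a2; b2]`_k.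
have [c0 [c1 [c2 tE]]] := O_section_quadratic n2 tO (v0 *m P5) (w1 *m P5) (w2 *m P5).
have [a [b [nz r]]] := binary_root c0 c1 c2.
pose w := a *: w1 + b *: w2.
have vw : wedge v0 w != 0.
  have wk (k : 'I_5) : w 0 k != 0 -> k != ord0 -> wedge v0 w != 0.
    move=> wk k0; apply: (@wedge_neq0 _ _ _ _ ord0 k).
    suff -> : v0 0 k = 0 by rewrite mulr0 subr0 [v0 _ _]mxE /= mul1r.
    by rewrite mxE; case: k k0 {wk} => [[|[|[|[|[|//]]]]] hk].
  have wE k : (k < 5)%N -> w 0 (inord k) = a * [:: 0; a1; b1; 0; 0]`_k + b * [:: 0; 0; 0; a2; b2]`_k.
    by move=> hk; rewrite !mxE inordK.
  have wk' k : (0 < k < 5)%N -> w 0 (inord k) != 0 -> wedge v0 w != 0.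
    by move=> /andP[k0 k5] /wk; apply; rewrite -val_eqE /= inordK // -lt0n.
  case/orP: nz => z; [case/orP: nz1 => z1 | case/orP: nz2 => z2].
  - by apply: (wk' 1%N); rewrite // wE //= mulr0 addr0 mulf_neq0.
  - by apply: (wk' 2); rewrite // wE //= mulr0 addr0 mulf_neq0.
  - by apply: (wk' 3); rewrite // wE //= mulr0 add0r mulf_neq0.
  - by apply: (wk' 4); rewrite // wE //= mulr0 add0r mulf_neq0.
pose A := pairmx (v0 *m P5) (w *m P5).
have AE : A = pairmx v0 w *m P5.
  by apply/esym/pairmxP; rewrite row_mul ?row0_pairmx ?row1_pairmx.
have fA : row_free A by rewrite AE /row_free mxrankMfree // -/(row_free _) row_free_pairmx.
have sum5 (F : 'I_5 -> C) : \sum_k F k = F (inord 0) + F (inord 1) + F (inord 2) + F (inord 3) + F (inord 4).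
  rewrite !big_ord_recr big_ord0 /= add0r.
  by congr (F _ + F _ + F _ + F _ + F _); apply/val_inj; rewrite /= inordK.
have d'0 : d 0 (g (inord 0)) = 0.
  by rewrite (_ : inord 0 = ord0) ?g0 //; apply/val_inj; rewrite /= inordK.
have sA : s A = 0.
  rewrite sQ // mul_pairmx !(qform_diag _ _ P5Q) !sum5 !mxE !inordK //= d'0.
  rewrite -!/(d' _); apply/matrixP; elim/ord2P; elim/ord2P; rewrite !mxE /=; try by ring.
  transitivity (a ^+ 2 * (d' 1%N * a1 ^+ 2 + 0 * (a1 * b1) + d' 2 * b1 ^+ 2)
    + b ^+ 2 * (d' 3 * a2 ^+ 2 + 0 * (a2 * b2) + d' 4 * b2 ^+ 2)); first by ring.
  by rewrite r1 r2 !mulr0 addr0.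
have tA : t A = 0.
  have := tE a b; rewrite r !scalemxAl -mulmxDl -/w.
  by rewrite ifF //; apply/negbTE; rewrite -row_free_pairmx.
have [h [I [hu hI]]] := chart_exists fA.
case: (tO) => tM _.
have fhA : row_free (h *m A) by rewrite row_free_mull.
have shA : s (h *m A) = 0.
  by rewrite sQ // trmx_mul !mulmxA -(mulmxA h) -(mulmxA h) -sQ // sA mulmx0 mul0mx.
have thA : t (h *m A) = 0 by rewrite tM // tA mulr0.
(* Coordinates of the kernel vector in the basis adapted to the chart. *)
pose lam : 'rV[C]_2 := row 0 (invmx h).
have lamA : lam *m (h *m A) = v0 *m P5.
  by rewrite -row_mul mulmxA mulVmx // mul1mx row0_pairmx.
have vQ : v0 *m P5 *m Q = 0.
  have -> : v0 *m P5 = row i P.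
    rewrite -g0 -[row _ P](_ : row ord0 P5 = _); last by apply/rowP => l; rewrite !mxE.
    rewrite rowE; congr (_ *m _); apply/rowP => k; rewrite !mxE eqxx /=.
    by case: k => [[|[|[|[|[|//]]]]] hk].
  have PTu : P^T \in unitmx by rewrite unitmx_tr.
  rewrite -[LHS](mulmxK PTu) -!row_mul PQ; apply/rowP => l.
  rewrite [RHS]mxE 2!mxE big1 // => m _; rewrite !mxE.
  by case: eqP => [<- | _]; rewrite ?di ?mulr0n mul0r.
clearbody lam; have /rV0Pn[k lk] : lam != 0.
  apply: contraNneq vw => l0; move: lamA; rewrite l0 mul0mx -(mul0mx _ P5).
  by move/(row_free_inj P5free) => <-; rewrite wedgeC wedge0r oppr0.
(* A derivative A Q B^T + B Q A^T of the Gram matrix takes the value 0 at [lam], whereas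
   [delta_mx k k] takes the square of its k-th coordinate, which is nonzero. *)
have ST : (delta_mx k k : 'M[C]_2)^T = delta_mx k k by rewrite trmx_delta.
have [B [BI sB _]] := sm I _ hI shA thA _ 0 ST.
have := S2_chart_deriv sQ hI BI sB; move: (h *m A) lamA => A' lamA.
move/(congr1 (fun X => (lam *m X *m lam^T) 0 0)).
rewrite mulmxDr mulmxDl !mulmxA lamA vQ !mul0mx add0r.
have -> : lam *m B *m Q *m A'^T *m lam^T = (lam *m B) *m (lam *m A' *m Q)^T.
  by rewrite !trmx_mul QT !mulmxA.
rewrite lamA vQ trmx0 mulmx0 [RHS]mxE -(mul_delta_mx (0 : 'I_1)) mulmxA -mulmxA.
by rewrite -colE -rowE mxE big_ord1 !mxE => /eqP; rewrite mulf_eq0 (negbTE lk).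
Qed.

End Nondegenerate.

(** * Hyperbolic coordinates for a nondegenerate form *)

Section Hyperbolic.
Variable C : numClosedFieldType.

Lemma symmetric_unit_square n (Q : 'M[C]_n) : Q^T = Q -> exists K : 'M[C]_n, Q = K *m K^T.
Proof.
move=> QT; have [P Pu [d PQ]] := symmetric_diagonal QT.
exists (invmx P *m diag_mx (\row_i sqrtC (d 0 i))).
rewrite trmx_mul tr_diag_mx !mulmxA -(mulmxA (invmx P)) mulmx_diag.
have -> : \row_j ((\row_i sqrtC (d 0 i)) 0 j * (\row_i sqrtC (d 0 i)) 0 j) = d.
  by apply/rowP => j; rewrite !mxE -expr2 sqrtCK.
by rewrite -PQ !mulmxA mulVmx // mul1mx trmx_inv -mulmxA mulmxV ?unitmx_tr // mulmx1.
Qed.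

Lemma hyperbolic_basis (Q : 'M[C]_6) : Q^T = Q -> Q \in unitmx ->
  exists2 K, K \in unitmx & forall u v, qform Q u v = bil (u *m K) (v *m K).
Proof.
move=> QT Qu; have [K1 QE] := symmetric_unit_square QT.
(* From a sum of squares to [bil]: x_b^2 + x_{b+3}^2 factors as (x_b + i x_{b+3}) (x_b - i x_{b+3}),
   and the second factor is halved because [bil] counts each product twice. *)
pose K2 : 'M[C]_6 := \matrix_(a, b)
  if (b < 3)%N then (a == b)%:R + 'i * (a == b + 3 :> nat)%N%:R
  else ((a == b - 3 :> nat)%N%:R - 'i * (a == b)%:R) / 2.
have K2E x y : bil (x *m K2) (y *m K2) = \sum_k x 0 k * y 0 k.
  have c (z : 'rV[C]_6) b : (z *m K2) 0 b = \sum_a z 0 a * K2 a b by rewrite mxE.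
  rewrite bilE !c !sum6 ![K2 _ _]mxE !inordK //= -!val_eqE /= !inordK //=.
  have i2 : 'i * 'i = -1 :> C by rewrite -expr2 sqrCi.
  rewrite ?mulr0n ?mulr1n ?mulr0 ?mulr1 ?addr0 ?add0r ?subr0 ?sub0r ?mul0r ?oppr0 ?mul0r ?mulr0 ?addr0 ?add0r.
  transitivity (x 0 (inord 0) * y 0 (inord 0) + x 0 (inord 1) * y 0 (inord 1) + x 0 (inord 2) * y 0 (inord 2)
    - 'i * 'i * (x 0 (inord 3) * y 0 (inord 3) + x 0 (inord 4) * y 0 (inord 4) + x 0 (inord 5) * y 0 (inord 5))).
    by field.
  rewrite i2; ring.
have KE u v : qform Q u v = bil (u *m (K1 *m K2)) (v *m (K1 *m K2)).
  rewrite !mulmxA K2E /qform QE mulmxA -mulmxA -trmx_mul mxE.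
  by apply: eq_bigr => k _; rewrite [X in _ * X]mxE.
exists (K1 *m K2) => //; rewrite -row_free_unit; apply: inj_row_free => u u0.
have uQ : u *m Q = 0.
  apply/rowP => j; have := KE u (delta_mx 0 j); rewrite u0.
  rewrite /qform trmx_delta -colE !mxE => ->.
  by rewrite /bil big1 // => k _; rewrite mxE mul0r.
by rewrite -[u](mulmxK Qu) uQ mul0mx.
Qed.
End Hyperbolic.

(** * Coordinates on varieties *)

Section PolynomialFunctions.
Variables (C : numClosedFieldType) (n : nat).

Definition polyfun (f : 'rV[C]_n -> C) := exists p : {mpoly C[n]}, forall v, f v = p.@[v 0].

(** Common to polynomial functions and to forms of a fixed bidegree, so that one lemma shows both to
    be stable under linear maps such as [plucker]. *)
Definition linear_class (P : ('rV[C]_n -> C) -> Prop) :=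
  [/\ P (fun=> 0), forall f g, P f -> P g -> P (fun v => f v + g v)
    & forall c f, P f -> P (fun v => c * f v)].

Definition mxclass (P : ('rV[C]_n -> C) -> Prop) a b (f : 'rV[C]_n -> 'M[C]_(a, b)) :=
  forall i j, P (fun v => f v i j).

Lemma linear_class_sum P (I : Type) (r : seq I) (f : I -> 'rV[C]_n -> C) :
  linear_class P -> (forall i, P (f i)) -> P (fun v => \sum_(i <- r) f i v).
Proof.
move=> [P0 PD _] Pf; elim: r => [|i r IH].
  by rewrite (_ : (fun _ => _) = fun=> 0) //; apply/funext => v; rewrite big_nil.
rewrite (_ : (fun _ => _) = fun v => f i v + \sum_(j <- r) f j v); first exact: PD.
by apply/funext => v; rewrite big_cons.
Qed.

Lemma mxclass_linear P a b c d (L : {linear 'M[C]_(a, b) -> 'M[C]_(c, d)})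
    (f : 'rV[C]_n -> 'M[C]_(a, b)) :
  linear_class P -> mxclass P f -> mxclass P (fun v => L (f v)).
Proof.
move=> PL Pf i j; have [_ _ PZ] := PL.
rewrite (_ : (fun _ => _) = fun v => \sum_k \sum_l L (delta_mx k l) i j * f v k l).
  by do 2!apply: linear_class_sum => // ?; apply: PZ.
apply/funext => v; rewrite {1}(matrix_sum_delta (f v)) linear_sum summxE.
apply: eq_bigr => k _; rewrite linear_sum summxE; apply: eq_bigr => l _.
by rewrite linearZ mxE mulrC.
Qed.

Lemma mxclass_row_mx P a b c (f : 'rV[C]_n -> 'M[C]_(a, b)) (g : 'rV[C]_n -> 'M[C]_(a, c)) :
  mxclass P f -> mxclass P g -> mxclass P (fun v => row_mx (f v) (g v)).
Proof.
move=> Pf Pg i j; case: (split_ordP j) => k ->.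
  by rewrite (_ : (fun _ => _) = fun v => f v i k) //; apply/funext => v; rewrite row_mxEl.
by rewrite (_ : (fun _ => _) = fun v => g v i k) //; apply/funext => v; rewrite row_mxEr.
Qed.

Lemma polyfun_linear_class : linear_class polyfun.
Proof.
split=> [|f g [p pE] [q qE]|c f [p pE]].
- by exists 0 => v; rewrite meval0.
- by exists (p + q) => v; rewrite mevalD pE qE.
- by exists (c *: p) => v; rewrite mevalZ pE.
Qed.

Lemma polyfunM f g : polyfun f -> polyfun g -> polyfun (fun v => f v * g v).
Proof. by move=> [p pE] [q qE]; exists (p * q) => v; rewrite mevalM pE qE. Qed.

Lemma polyfun_coord i : polyfun (fun v => v 0 i).
Proof. by exists 'X_i => v; rewrite mevalXU. Qed.

Lemma polymx_mul a b c (f : 'rV[C]_n -> 'M[C]_(a, b)) (g : 'rV[C]_n -> 'M[C]_(b, c)) :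
  mxclass polyfun f -> mxclass polyfun g -> mxclass polyfun (fun v => f v *m g v).
Proof.
move=> Pf Pg i j; rewrite (_ : (fun _ => _) = fun v => \sum_k f v i k * g v k j).
  by apply: linear_class_sum => [|k]; [exact: polyfun_linear_class | exact: polyfunM].
by apply/funext => v; rewrite mxE.
Qed.

Lemma polymx_id : mxclass polyfun (fun v : 'rV[C]_n => v).
Proof. by move=> i j; rewrite (ord1 i); apply: polyfun_coord. Qed.

Lemma polyfun_comp m (f : 'rV[C]_n -> 'rV[C]_m) (q : {mpoly C[m]}) :
  mxclass polyfun f -> exists p : {mpoly C[n]}, forall v : 'rV[C]_n, p.@[v 0] = q.@[f v 0].
Proof.
move=> Pf; have /fin_all_exists[p pE] j : exists p : {mpoly C[n]}, forall v, f v 0 j = p.@[v 0].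
  exact: Pf.
exists (q \mPo [tuple p j | j < m]) => v; rewrite comp_mpoly_meval.
by apply: meval_eq => j; rewrite tnth_mktuple pE.
Qed.

End PolynomialFunctions.

Section Isomorphisms.
Variable C : numClosedFieldType.
Implicit Types X Y : Defs.space C.

(* Coordinate vectors are not unique, so the lift has to reach every given
   coordinate vector w of y: regularity is tested at one of them only. *)
Definition local_lift X Y (r : X -> Y -> Prop) := forall x y w, r x y -> crep w y ->
  exists (v : 'rV[C]_(ncoord X)) (Q : {mpoly C[ncoord X]})
         (phi : 'rV[C]_(ncoord X) -> 'rV[C]_(ncoord Y)),
    [/\ crep v x, Q.@[v 0] != 0, phi v = w, mxclass (@polyfun _ _) phi &
        forall x' v', crep v' x' -> Q.@[v' 0] != 0 ->
          exists2 y', r x' y' & crep (phi v') y'].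

(** Open sets and fractions are pulled back along [phi]; the factor [Q0] confines them to the locus
    where [phi] represents the image point. *)
Lemma morphism_of_lift X Y (r : X -> Y -> Prop) (f : X -> Y) :
  local_lift r -> (forall x, r x (f x)) -> (forall x y, r x y -> y = f x) -> morphism f.
Proof.
move=> lift rf fr; split.
  move=> V oV x /oV[Q [w cw Qw] QV].
  have [v [Q0 [phi [cv Q0v pv Pphi L]]]] := lift x (f x) w (rf x) cw.
  have [p pE] := polyfun_comp Q Pphi.
  exists (Q0 * p); first by exists v; rewrite // mevalM pE pv mulf_neq0.
  move=> x' [v' cv']; rewrite mevalM mulf_eq0 negb_or pE => /andP[Q0v' Qv'].
  have [y' /fr -> cy'] := L _ _ cv' Q0v'.
  by apply: QV; exists (phi v').
move=> g x [P [Q [w cw Qw] PQ]].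
have [v [Q0 [phi [cv Q0v pv Pphi L]]]] := lift x (f x) w (rf x) cw.
have [p pE] := polyfun_comp P Pphi; have [q qE] := polyfun_comp Q Pphi.
exists (Q0 * p), (Q0 * q); first by exists v; rewrite // mevalM qE pv mulf_neq0.
move=> x' v' cv'; rewrite !mevalM mulf_eq0 negb_or qE pE => /andP[Q0v' Qv'].
have [y' /fr -> cy'] := L _ _ cv' Q0v'.
by rewrite (PQ _ _ cy' Qv') -mulf_div divff // mul1r.
Qed.

Lemma isomorphic_of_relation X Y (r : X -> Y -> Prop) :
  (forall x, exists y, r x y) -> (forall y, exists x, r x y) ->
  (forall x y y', r x y -> r x y' -> y = y') -> (forall x x' y, r x y -> r x' y -> x = x') ->
  local_lift r -> local_lift (fun y x => r x y) -> isomorphic X Y.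
Proof.
move=> /choice[f rf] /choice[g rg] rY rX lf lg; exists f, g; split.
- by apply: (morphism_of_lift lf rf) => x y xy; exact: rY xy (rf x).
- by apply: (morphism_of_lift lg) => [//|y x xy]; exact: rX xy (rg y).
- by move=> x; exact: rX (rg (f x)) (rf x).
- by move=> y; exact: rY (rf (g y)) (rg y).
Qed.

End Isomorphisms.

(** * Points of the Grassmannian and their basis matrices *)

Section Grassmannian.
Variable C : numClosedFieldType.
Variables k n : nat.
Implicit Types (A B : 'M[C]_(k, n)) (U : Gr C k n).

Lemma mem_span_rows A (u : 'rV[C]_n) :
  (u \in <<[seq row i A | i : 'I_k]>>%VS) = (u <= A)%MS.
Proof.
pose X := [tuple row i A | i < k].
have XE : [seq row i A | i : 'I_k] = X by [].
have Xi (i : 'I_k) : X`_i = row i A by rewrite -tnth_nth tnth_mktuple.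
rewrite XE; apply/idP/idP => [/coord_span -> | /submxP[D ->]].
  by apply: summx_sub => i _; apply: scalemx_sub; rewrite Xi row_sub.
rewrite mulmx_sum_row; apply: memv_suml => i _; apply: memvZ; rewrite -Xi.
by apply: memv_span; rewrite mem_nth // size_tuple.
Qed.

Lemma dim_span_rows A : (\dim <<[seq row i A | i : 'I_k]>> == k)%VS = row_free A.
Proof.
pose X := [tuple row i A | i < k].
have XE : [seq row i A | i : 'I_k] = X by [].
have Xi (i : 'I_k) : X`_i = row i A by rewrite -tnth_nth tnth_mktuple.
rewrite XE -{2}(size_tuple X) -/(free X); apply/freeP/idP => [h | fA d].
  apply: inj_row_free => r; rewrite mulmx_sum_row => r0; apply/rowP => i.
  rewrite mxE; apply: h; rewrite -[RHS]r0; apply: eq_bigr => j _; by rewrite Xi.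
move=> d0 i; have inj := row_free_inj fA.
have /inj/rowP/(_ i) : (\row_j d j) *m A = 0 *m A.
  by rewrite mul0mx -[RHS]d0 mulmx_sum_row; apply: eq_bigr => j _; rewrite mxE Xi.
by rewrite !mxE.
Qed.

Lemma crep_row_free v U : crep v U -> row_free (vec_mx v : 'M[C]_(k, n)).
Proof. by move=> vU; rewrite -dim_span_rows [X in \dim X]vU (svalP U). Qed.

Lemma crep_exists A : row_free A -> exists U, @crep C (Gr C k n) (mxvec A) U.
Proof.
rewrite -dim_span_rows => /eqP dA.
by exists (exist (fun U : {vspace 'rV[C]_n} => \dim U = k) _ dA); rewrite /= mxvecK.
Qed.

Lemma crep_rep U : exists2 A, @crep C (Gr C k n) (mxvec A) U & row_free A.
Proof.
case: U => U dU; pose X := vbasis U.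
pose A : 'M[C]_(k, n) := \matrix_(i < k) (vbasis U)`_i.
have AU : <<[seq row i A | i : 'I_k]>>%VS = U.
  rewrite -[RHS](span_basis (vbasisP U)); congr (<<_>>)%VS.
  apply: (@eq_from_nth _ 0) => [|i].
    by rewrite size_map size_enum_ord size_tuple dU.
  rewrite size_map size_enum_ord => ik.
  by rewrite (nth_map (Ordinal ik)) ?size_enum_ord // rowK nth_enum_ord.
exists A; first by rewrite /= mxvecK.
by rewrite -dim_span_rows AU dU.
Qed.

Lemma crep_inj v U U' : crep v U -> crep v U' -> U = U'.
Proof.
case: U U' => U dU [U' dU'] /= vU vU'; have UU : U = U' by rewrite -vU -vU'.
by case: _ / UU dU' {vU'} => dU'; congr exist; exact: eq_irrelevance.
Qed.

Lemma crep_change v w U : crep v U -> crep w U ->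
  exists2 g, g \in unitmx & (vec_mx w : 'M[C]_(k, n)) = g *m vec_mx v.
Proof.
move=> vU wU; have fw := crep_row_free wU; rewrite /= in vU wU.
have /submxP[g gE] : (vec_mx w <= (vec_mx v : 'M[C]_(k, n)))%MS.
  apply/row_subP => i; rewrite -mem_span_rows vU -wU mem_span_rows.
  exact: row_sub.
exists g => //; rewrite -row_free_unit /row_free eqn_leq rank_leq_row.
by rewrite -{1}(eqP fw) gE mxrankM_maxl.
Qed.

Lemma crep_mull v U g : crep v U -> g \in unitmx ->
  @crep C (Gr C k n) (mxvec (g *m vec_mx v)) U.
Proof.
move=> vU gu; rewrite /= -[RHS]vU mxvecK; apply/vspaceP => u.
by rewrite !mem_span_rows eqmxMfull // row_full_unit.
Qed.

End Grassmannian.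

(** * Bihomogeneous forms on P^3 x P^3 *)

Section Bihomogeneous.
Variable C : numClosedFieldType.
Notation P := (P3xP3 C).
Notation N := (ncoord (Proj C 3)).

Definition xpart (w : 'rV[C]_(ncoord P)) : 'rV[C]_4 := vec_mx (lsubmx (w : 'rV_(N + N))).
Definition ypart (w : 'rV[C]_(ncoord P)) : 'rV[C]_4 := vec_mx (rsubmx (w : 'rV_(N + N))).

(** Unlike [bidegree], this admits the zero polynomial, so that forms of one bidegree make a linear
    class. *)
Definition bihomogeneous (a b : nat) (F : {mpoly C[ncoord P]}) :=
  forall m, m \in msupp F ->
    (\sum_(i < N) m (lshift N i) = a)%N /\ (\sum_(i < N) m (rshift N i) = b)%N.

Definition bipoly a b (f : 'rV[C]_(ncoord P) -> C) :=
  exists2 F, bihomogeneous a b F & forall w, f w = F.@[w 0].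

Lemma bipoly_linear_class a b : linear_class (bipoly a b).
Proof.
split=> [|f g [p pb pE] [q qb qE]|c f [p pb pE]].
- by exists 0 => [m|w]; rewrite ?meval0 // msupp0.
- exists (p + q) => [m|w]; last by rewrite mevalD pE qE.
  by move=> /msuppD_le; rewrite mem_cat => /orP[/pb|/qb].
- exists (c *: p) => [m|w]; last by rewrite mevalZ pE.
  by move=> /msuppZ_le/pb.
Qed.

Lemma bipolyM a b a' b' f g : bipoly a b f -> bipoly a' b' g ->
  bipoly (a + a') (b + b') (fun w => f w * g w).
Proof.
move=> [p pb pE] [q qb qE]; exists (p * q) => [m|w]; last by rewrite mevalM pE qE.
move=> /msuppM_le/allpairsP[[m1 m2] /= [/pb[<- <-] /qb[<- <-] ->]].
by split; rewrite -big_split; apply: eq_bigr => i _; rewrite mnmDE.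
Qed.

Lemma bipoly_x : mxclass (bipoly 1 0) xpart.
Proof.
move=> i j; pose k : 'I_N := mxvec_index i j.
exists 'X_(lshift N k) => [m|w]; last by rewrite mevalXU !mxE.
move=> /mem_msuppXP <-; split.
  rewrite (bigD1 k) //= mnm1E eqxx big1 // => l lk.
  by rewrite mnm1E (inj_eq (@lshift_inj _ _)) eq_sym (negbTE lk).
by rewrite big1 // => l _; rewrite mnm1E eq_lrshift.
Qed.

Lemma bipoly_y : mxclass (bipoly 0 1) ypart.
Proof.
move=> i j; pose k : 'I_N := mxvec_index i j.
exists 'X_(rshift N k) => [m|w]; last by rewrite mevalXU !mxE.
move=> /mem_msuppXP <-; split.
  by rewrite big1 // => l _; rewrite mnm1E eq_rlshift.
rewrite (bigD1 k) //= mnm1E eqxx big1 // => l lk.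
by rewrite mnm1E (inj_eq (@rshift_inj _ _)) eq_sym (negbTE lk).
Qed.

Definition segre w : 'M[C]_4 := (ypart w)^T *m xpart w.

Lemma bipoly_segre : mxclass (bipoly 1 1) segre.
Proof.
move=> i j; have [F Fb FE] := bipolyM (bipoly_x 0 j) (bipoly_y 0 i).
by exists F => // w; rewrite -FE mxE big_ord1 mxE mulrC.
Qed.

Lemma bipoly_pairing : bipoly 1 1 (fun w => (xpart w *m (ypart w)^T) 0 0).
Proof.
have := linear_class_sum (index_enum 'I_4) (bipoly_linear_class 1 1) (fun i => bipoly_segre i i).
by case=> F Fb FE; exists F => // w; rewrite -FE bil_rank1.
Qed.

Lemma bipoly_wedge_form n (L : {linear 'M[C]_4 -> 'M[C]_n}) (Q : 'I_n -> 'I_n -> 'M[C]_n) :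
  bipoly 2 2 (fun w => wedge_form Q (L (segre w)) (L (segre w))).
Proof.
apply: linear_class_sum => [|i]; first exact: bipoly_linear_class.
apply: linear_class_sum => [|j]; first exact: bipoly_linear_class.
have PL := mxclass_linear L (bipoly_linear_class 1 1) bipoly_segre.
have : bipoly 2 2 (fun w => \sum_l \sum_k L (segre w) k i * (Q i j k l * L (segre w) l j)).
  apply: linear_class_sum => [|l]; first exact: bipoly_linear_class.
  apply: linear_class_sum => [|k]; first exact: bipoly_linear_class.
  apply: (bipolyM (a := 1) (b := 1) (a' := 1) (b' := 1)) => //.
  by have [_ _ PZ] := bipoly_linear_class 1 1; apply: PZ.
case=> F Fb FE; exists F => // w; rewrite -FE mxE; apply: eq_bigr => l _.
by rewrite mxE mulr_suml; apply: eq_bigr => k _; rewrite mxE mulrA.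
Qed.

End Bihomogeneous.

Section Points.
Variable C : numClosedFieldType.
Notation P := (P3xP3 C).

Lemma row_free_neq0 n (x : 'rV[C]_n) : row_free x = (x != 0).
Proof. by rewrite /row_free rank_rV; case: (x != 0). Qed.

Lemma crep_xpart w (z : P) : crep w z -> xpart w != 0.
Proof. by case=> /crep_row_free h _; rewrite -row_free_neq0. Qed.

Lemma crep_ypart w (z : P) : crep w z -> ypart w != 0.
Proof. by case=> _ /crep_row_free h; rewrite -row_free_neq0. Qed.

Definition coords (x y : 'rV[C]_4) : 'rV[C]_(ncoord P) := row_mx (mxvec x) (mxvec y).

Lemma xpart_coords x y : xpart (coords x y) = x.
Proof. by rewrite /xpart row_mxKl mxvecK. Qed.

Lemma ypart_coords x y : ypart (coords x y) = y.
Proof. by rewrite /ypart row_mxKr mxvecK. Qed.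

Lemma coords_parts w : coords (xpart w) (ypart w) = w.
Proof. by rewrite /coords !vec_mxK hsubmxK. Qed.

Lemma crep_coords x y : x != 0 -> y != 0 -> exists z : P, crep (coords x y) z.
Proof.
rewrite -!row_free_neq0 => /crep_exists[X cX] /crep_exists[Y cY].
exists (X, Y); split; rewrite ?row_mxKl ?row_mxKr //.
Qed.

Lemma crep_scale w w' (z : P) : crep w z -> crep w' z ->
  exists a b, [/\ a != 0, b != 0, xpart w' = a *: xpart w & ypart w' = b *: ypart w].
Proof.
move=> [wx wy] [w'x w'y].
have [g gu gE] := crep_change wx w'x; have [h hu hE] := crep_change wy w'y.
exists (g 0 0), (h 0 0); split.
- by move: gu; rewrite unitmxE det_mx11 unitfE.
- by move: hu; rewrite unitmxE det_mx11 unitfE.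
- by rewrite /xpart gE [g]mx11_scalar mul_scalar_mx mxE eqxx mulr1n.
- by rewrite /ypart hE [h]mx11_scalar mul_scalar_mx mxE eqxx mulr1n.
Qed.

Lemma crep_uniq w w' (z z' : P) a b : crep w z -> crep w' z' ->
  xpart w' = a *: xpart w -> ypart w' = b *: ypart w -> z = z'.
Proof.
move=> cw cw' xE yE.
have a0 : a != 0 by have := crep_xpart cw'; rewrite xE scaler_eq0 negb_or => /andP[].
have b0 : b != 0 by have := crep_ypart cw'; rewrite yE scaler_eq0 negb_or => /andP[].
case: z z' cw cw' => [X Y] [X' Y'] [/= wx wy] [/= w'x w'y].
have sc n (c : C) (v v' : 'rV[C]_(1 * n)) (U U' : Gr C 1 n) : c != 0 -> @crep _ (Gr C 1 n) v U ->
    @crep _ (Gr C 1 n) v' U' -> vec_mx v' = c *: vec_mx v -> U = U'.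
  move=> c0 vU vU' E.
  have cu : c%:M \in @unitmx C 1 by rewrite unitmxE det_scalar1 unitfE.
  apply: (crep_inj (crep_mull vU cu)).
  by rewrite mul_scalar_mx -E vec_mxK.
congr (_, _); [exact: (sc _ _ _ _ _ _ a0 wx w'x xE) | exact: (sc _ _ _ _ _ _ b0 wy w'y yE)].
Qed.
Lemma crep_point (z : P) : exists w, crep w z.
Proof.
have [X cX _] := crep_rep z.1; have [Y cY _] := crep_rep z.2.
by exists (coords X Y); split; rewrite ?row_mxKl ?row_mxKr.
Qed.

End Points.

(** * Isotropic planes and flags *)

Section Flags.
Variable C : numFieldType.

Lemma incident_rows x y m (B : 'M[C]_(m, 6)) : (forall i, incident x y (row i B)) ->
  forall r : 'rV_m, incident x y (r *m B).
Proof.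
move=> iB r; rewrite mulmx_sum_row; elim/big_rec: _ => [|i u _ iu].
  by rewrite /incident !linear0 !mul0mx.
exact: incident_lin.
Qed.

Lemma incident_scale x y (a b : C) u : incident x y u -> incident (a *: x) (b *: y) u.
Proof. by move=> [h1 h2]; split; rewrite linearZ /= -scalemxAr ?h1 ?h2 scaler0. Qed.

Lemma wedge_mul n m (u v : 'rV[C]_n) (A : 'M[C]_(n, m)) :
  wedge (u *m A) (v *m A) = A^T *m wedge u v *m A.
Proof. by rewrite /wedge mulmxBr mulmxBl !trmx_mul !mulmxA. Qed.

Lemma wedge_line n (u v u' v' : 'rV[C]_n) a : wedge (u + a *: u') (v + a *: v') =
  wedge u v + a *: (wedge u' v + wedge u v') + a ^+ 2 *: wedge u' v'.
Proof.
have wE x y : wedge x y = \matrix_(i, j) (x 0 i * y 0 j - y 0 i * x 0 j) :> 'M[C]_n.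
  by apply/matrixP => i j; rewrite wedgeE mxE.
by rewrite !wE; apply/matrixP => i j; rewrite !mxE; ring.
Qed.

(** With J = [mx2 0 1 (-1) 0], the Pluecker matrix of A is A^T J A; multiplying that of A' by a
    right inverse of A' on the appropriate side isolates J A', and hence writes A' as g A. *)
Lemma wedge_span n (u v u' v' : 'rV[C]_n) c :
  wedge u' v' != 0 -> wedge u' v' = c *: wedge u v ->
  exists2 g, g \in unitmx & pairmx u' v' = g *m pairmx u v.
Proof.
move=> uv' E; set A := pairmx u v; set A' := pairmx u' v'.
have fA' : row_free A' by rewrite row_free_pairmx.
have WE (x y : 'rV[C]_n) : wedge x y = (pairmx x y)^T *m (mx2 0 1 (-1) 0 *m pairmx x y).
  rewrite mx2_pairmx !scale0r add0r addr0 scaleN1r scale1r.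
  apply/matrixP => i j; rewrite wedgeE mxE !big_ord_recl big_ord0 !mxE /=; ring.
have [X AX] : exists X, A' *m X = 1%:M by apply/row_freeP.
pose g := c *: (mx2 0 (-1) 1 0 *m X^T *m A^T *m mx2 0 1 (-1) 0).
have gE : A' = g *m A.
  have : X^T *m wedge u' v' = mx2 0 1 (-1) 0 *m A'.
    by rewrite WE mulmxA -trmx_mul AX trmx1 mul1mx.
  move/(congr1 (mulmx (mx2 0 (-1) 1 0))); rewrite E.
  have -> : mx2 0 (-1) 1 0 *m (mx2 0 1 (-1) 0 *m A') = A'.
    by rewrite /A' !mx2_pairmx !scale0r !add0r !addr0 !scale1r scaleN1r scaleN1r opprK.
  move=> <-; rewrite /g WE -/A -!scalemxAr -!scalemxAl !mulmxA //.
exists g => //; rewrite -row_free_unit /row_free eqn_leq rank_leq_row.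
by rewrite -{1}(eqP fA') gE mxrankM_maxl.
Qed.

End Flags.

(** * The correspondence between isotropic planes and pairs of spinors *)

Section Geometry.
Variable C : numClosedFieldType.
Notation P := (P3xP3 C).
Variables (Q K : 'M[C]_6) (s : 'M[C]_(2, 6) -> 'M[C]_2) (t : 'M[C]_(2, 6) -> C).
Variable T : 'I_6 -> 'I_6 -> 'M[C]_6.
Hypothesis K_unit : K \in unitmx.
Hypothesis QK : forall u v, qform Q u v = bil (u *m K) (v *m K).
Hypothesis sQ : forall A, row_free A -> s A = A *m Q *m A^T.
Hypothesis tO : O_section 2 t.
Hypothesis tT : forall u v, wedge u v != 0 ->
  t (pairmx u v) = wedge_form T (wedge u v) (wedge u v).

(** Spinors live in the hyperbolic coordinates and t in the original ones; [pull] transports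
    Pluecker matrices back to the latter. *)
Definition pull (p : 'M[C]_6) : 'M[C]_6 := (invmx K)^T *m p *m invmx K.

Lemma pull_is_linear : linear pull.
Proof. by move=> c p q; rewrite /pull mulmxDr mulmxDl -scalemxAr -scalemxAl. Qed.

HB.instance Definition _ :=
  GRing.isLinear.Build C 'M[C]_6 'M[C]_6 _ pull pull_is_linear.

Definition gform p p' := wedge_form T (pull p) (pull p').

Lemma pull_wedge u v : pull (wedge (u *m K) (v *m K)) = wedge u v.
Proof. by rewrite /pull -wedge_mul !mulmxK. Qed.

Lemma gformDl p1 p2 p' : gform (p1 + p2) p' = gform p1 p' + gform p2 p'.
Proof. by rewrite /gform linearD wedge_formDl. Qed.

Lemma gformDr p p1 p2 : gform p (p1 + p2) = gform p p1 + gform p p2.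
Proof. by rewrite /gform linearD wedge_formDr. Qed.

Lemma gformZl c p p' : gform (c *: p) p' = c * gform p p'.
Proof. by rewrite /gform linearZ wedge_formZl. Qed.

Lemma gformZr c p p' : gform p (c *: p') = c * gform p p'.
Proof. by rewrite /gform linearZ wedge_formZr. Qed.

Lemma gformZ c p : gform (c *: p) (c *: p) = c ^+ 2 * gform p p.
Proof. by rewrite gformZl gformZr expr2 mulrA. Qed.

Definition frame (v : 'rV[C]_(ncoord (Gr C 2 6))) : 'M[C]_(2, 6) :=
  (vec_mx v : 'M[C]_(2, 6)) *m K.

Lemma frame_wedge v (U : Gr C 2 6) : crep v U ->
  wedge (row 0 (frame v)) (row 1 (frame v)) != 0.
Proof.
move=> /crep_row_free h; rewrite -row_free_pairmx pairmx_rows /frame /row_free.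
by rewrite mxrankMfree // row_free_unit.
Qed.

Lemma section_s v (U : Gr C 2 6) : crep v U ->
  s (vec_mx v) = 0 <-> isotropic_pair (row 0 (frame v)) (row 1 (frame v)).
Proof.
move=> /crep_row_free h; rewrite (sQ h) -{1 2}[vec_mx v]pairmx_rows mul_pairmx !QK -!row_mul.
rewrite -/(frame v); set u := row 0 _; set w := row 1 _; split.
  move/matrixP => E; split; [have := E 0 0 | have := E 0 1 | have := E 1 1]; by rewrite !mxE.
by case=> h1 h2 h3; apply/matrixP; elim/ord2P; elim/ord2P; rewrite !mxE /= ?h1 ?h2 ?h3 // bilC.
Qed.

Lemma section_row_free A : row_free A ->
  let w := wedge (row 0 (A *m K)) (row 1 (A *m K)) in t A = gform w w.
Proof.
rewrite /gform !row_mul pull_wedge -{1 2}[A]pairmx_rows row_free_pairmx.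
exact: tT.
Qed.

Lemma section_t v (U : Gr C 2 6) : crep v U ->
  let w := wedge (row 0 (frame v)) (row 1 (frame v)) in t (vec_mx v) = gform w w.
Proof. by move=> /crep_row_free/section_row_free. Qed.

Lemma zero_locusP v (U : Gr C 2 6) : crep v U ->
  zero_locus s t U <-> s (vec_mx v) = 0 /\ t (vec_mx v) = 0.
Proof.
move=> vU; split=> [/(_ v vU) // | [sv tv] v' v'U].
have fv := crep_row_free vU; have [g gu gE] := crep_change vU v'U.
have fv' := crep_row_free v'U; rewrite gE in fv' *; split.
  by rewrite sQ // trmx_mul !mulmxA -(mulmxA g) -(mulmxA g) -sQ // sv mulmx0 mul0mx.
by have [-> //] := tO; rewrite tv mulr0.
Qed.

(** Quantifying over all coordinate vectors makes this a relation between points; [flag_intro]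
    reduces it to one choice. *)
Definition flag (U : Gr C 2 6) (z : P) := forall v w, crep v U -> crep w z ->
  forall i, incident (xpart w) (ypart w) (row i (frame v)).

Lemma flag_intro v w (U : Gr C 2 6) (z : P) : crep v U -> crep w z ->
  (forall i, incident (xpart w) (ypart w) (row i (frame v))) -> flag U z.
Proof.
move=> vU wz iv v' w' v'U w'z i.
have [g gu gE] := crep_change vU v'U; have [a [b [_ _ -> ->]]] := crep_scale wz w'z.
apply: incident_scale; rewrite /frame gE -mulmxA row_mul.
exact: incident_rows.
Qed.

Lemma flagP v w (U : Gr C 2 6) (z : P) : flag U z -> crep v U -> crep w z ->
  let u0 := row 0 (frame v) in let u1 := row 1 (frame v) in
  [/\ isotropic_pair u0 u1, (xpart w *m (ypart w)^T) 0 0 = 0 &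
    exists2 c, c != 0 & spin (star u0) *m spin u1 = c *: segre w
      /\ wedge u0 u1 = c *: plucker (segre w)].
Proof.
move=> f vU wz u0 u1; apply: incident_wedge; try exact: f vU wz _.
- exact: crep_xpart wz.
- exact: crep_ypart wz.
- exact: frame_wedge vU.
Qed.

Variables F G : {mpoly C[ncoord P]}.
Hypothesis FE : forall w, (xpart w *m (ypart w)^T) 0 0 = F.@[w 0].
Hypothesis GE : forall w, gform (plucker (segre w)) (plucker (segre w)) = G.@[w 0].

(** Incidence alone gives s = 0 and F = 0; the remaining equations t and G differ by a nonzero
    square, the Pluecker matrices being proportional. *)
Lemma flag_zero (U : Gr C 2 6) (z : P) : flag U z ->
  zero_locus s t U <-> divisors_meet F G z.
Proof.
move=> f; have [A AU _] := crep_rep U; set v := mxvec A in AU.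
have E w : crep w z -> (t (vec_mx v) == 0) = (G.@[w 0] == 0).
  move=> wz; have [_ _ [c c0 [_ wE]]] := flagP f AU wz.
  by rewrite (section_t AU) wE gformZ GE mulf_eq0 expf_eq0 (negbTE c0).
split=> [/(zero_locusP AU)[_ /eqP tv] w wz | m].
  split; first by have [_ h _] := flagP f AU wz; rewrite -FE.
  by apply/eqP; rewrite -(E w).
have [w wz] := crep_point z.
apply/(zero_locusP AU); split.
  by apply/(section_s AU); have [] := flagP f AU wz.
by apply/eqP; rewrite (E w) //; have [_ ->] := m w wz.
Qed.

(** The scalars [a] and [b] leave room to reach any prescribed coordinate vector of z, as
    [local_lift] demands. *)
Lemma flag_spinor v (U : Gr C 2 6) : crep v U ->
  isotropic_pair (row 0 (frame v)) (row 1 (frame v)) ->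
  let N := spin (star (row 0 (frame v))) *m spin (row 1 (frame v)) in
  forall k l a b, a != 0 -> b != 0 -> N k l != 0 ->
  exists2 z : P, flag U z & crep (coords (a *: row k N) (b *: (col l N)^T)) z.
Proof.
move=> vU iso N k l a b a0 b0 Nkl.
have uv := frame_wedge vU.
have x0 : a *: row k N != 0.
  rewrite scaler_eq0 (negbTE a0) /=; apply/rV0Pn; exists l; by have -> : row k N 0 l = N k l by rewrite mxE.
have y0 : b *: (col l N)^T != 0.
  rewrite scaler_eq0 (negbTE b0) /=; apply/rV0Pn; exists k; by have -> : (col l N)^T 0 k = N k l by rewrite mxE mxE.
have [z cz] := crep_coords x0 y0; exists z => //.
have [i0 i1] := incident_spinor k l uv iso.
apply: flag_intro vU cz _; rewrite xpart_coords ypart_coords.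
by elim/ord2P; apply: incident_scale.
Qed.

(** [h] leaves room to reach any prescribed basis of the plane. *)
Lemma flag_plane w (z : P) : crep w z -> (xpart w *m (ypart w)^T) 0 0 = 0 ->
  let p := plucker (segre w) in
  forall i j h, h \in unitmx -> p i j != 0 ->
  exists2 U : Gr C 2 6, flag U z &
    @crep _ (Gr C 2 6) (mxvec (h *m pairmx (row i p) (row j p) *m invmx K)) U.
Proof.
move=> wz xy0 p i j h hu pij; have uv := wedge_plucker_row xy0 pij.
have fA : row_free (h *m pairmx (row i p) (row j p) *m invmx K).
  by rewrite /row_free mxrankMfree ?row_free_unit ?unitmx_inv // -/(row_free _) row_free_mull // row_free_pairmx.
have [U cU] := crep_exists fA; exists U => //; apply: flag_intro cU wz _ => k.
rewrite /frame mxvecK mulmxKV // row_mul; apply: incident_rows.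
by elim/ord2P; rewrite ?row0_pairmx ?row1_pairmx; apply: spin_plucker.
Qed.

Lemma flag_uniq_plane (U U' : Gr C 2 6) (z : P) w : crep w z ->
  flag U z -> flag U' z -> U = U'.
Proof.
move=> wz f f'; have [A AU _] := crep_rep U; have [A' AU' _] := crep_rep U'.
have [_ _ [c c0 [_ E]]] := flagP f AU wz; have [_ _ [c' c'0 [_ E']]] := flagP f' AU' wz.
have /wedge_span[|g gu gE] : wedge (row 0 (frame (mxvec A'))) (row 1 (frame (mxvec A'))) =
    (c' / c) *: wedge (row 0 (frame (mxvec A))) (row 1 (frame (mxvec A))).
- by rewrite E E' scalerA divfK.
- exact: frame_wedge AU'.
rewrite !pairmx_rows /frame mulmxA in gE.
have AE : vec_mx (mxvec A') = g *m vec_mx (mxvec A).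
  by rewrite -[LHS](mulmxK K_unit) gE mulmxK.
by apply: (crep_inj (crep_mull AU gu)); rewrite -AE vec_mxK.
Qed.

Lemma flag_uniq_point (U : Gr C 2 6) (z z' : P) w w' : crep w z -> crep w' z' ->
  flag U z -> flag U z' -> z = z'.
Proof.
move=> wz wz' f f'; have [A AU _] := crep_rep U; have uv := frame_wedge AU.
have [u_y u_x] := f _ _ AU wz 0; have [v_y v_x] := f _ _ AU wz 1.
have [u_y' u_x'] := f' _ _ AU wz' 0; have [v_y' v_x'] := f' _ _ AU wz' 1.
have [b yE] := common_kernel uv (crep_ypart wz) u_y v_y u_y' v_y'.
have [a xE] := common_kernel (wedge_star uv) (crep_xpart wz) u_x v_x u_x' v_x'.
exact: crep_uniq wz wz' xE yE.
Qed.

Let X := sub (zero_locus s t).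
Let Y := sub (divisors_meet F G).
Let r (x : X) (y : Y) := flag (sval x) (sval y).

Lemma sub_inj (Z : Defs.space C) (S : Z -> Prop) (x y : sub S) : sval x = sval y -> x = y.
Proof.
case: x y => [x Sx] [y Sy] /= E; case: _ / E Sy => Sy.
by congr exist; exact: Prop_irrelevance.
Qed.

Lemma flag_point (x : X) : exists y, r x y.
Proof.
case: x => U zU; have [A AU _] := crep_rep U.
have iso : isotropic_pair (row 0 (frame (mxvec A))) (row 1 (frame (mxvec A))).
  by apply/(section_s AU); have [] := zU _ AU.
have [_ b0 _] := iso; have [k [l Nkl]] := spinor_neq0 (frame_wedge AU) b0.
have [z f _] := flag_spinor AU iso (oner_neq0 C) (oner_neq0 C) Nkl.
by exists (exist _ z ((flag_zero f).1 zU)).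
Qed.

Lemma flag_line (y : Y) : exists x, r x y.
Proof.
case: y => z m; have [w wz] := crep_point z.
have xy0 : (xpart w *m (ypart w)^T) 0 0 = 0 by rewrite FE; have [] := m w wz.
have [i [j pij]] := plucker_neq0 (crep_xpart wz) (crep_ypart wz) xy0.
have [U f _] := flag_plane wz xy0 (unitmx1 C 2) pij.
by exists (exist _ U ((flag_zero f).2 m)).
Qed.

Lemma polymx_segre : mxclass (@polyfun C _) (@segre C).
Proof. by move=> i j; have [p _ pE] := bipoly_segre C i j; exists p. Qed.

Lemma polymx_frame : mxclass (@polyfun C _) frame.
Proof.
apply: (mxclass_linear (mulmxr K : {linear _ -> _})); first exact: polyfun_linear_class.
apply: (mxclass_linear (vec_mx : {linear _ -> _})); first exact: polyfun_linear_class.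
exact: polymx_id.
Qed.

Lemma flag_lift_point : local_lift r.
Proof.
move=> [U zU] [z m] w /= f wz; have [A AU _] := crep_rep U; set v := mxvec A in AU.
pose N v := spin (star (row 0 (frame v))) *m spin (row 1 (frame v)).
have [_ _ [c c0 [NE _]]] := flagP f AU wz; rewrite -/(N v) in NE.
have /rV0Pn[l xl] := crep_xpart wz; have /rV0Pn[k yk] := crep_ypart wz.
have NklE i j : N v i j = c * (ypart w 0 i * xpart w 0 j) by rewrite NE mxE [segre w _ _]mxE big_ord1 [_^T _ _]mxE.
have PN : mxclass (@polyfun C _) N.
  have PL := @polyfun_linear_class C (ncoord (Gr C 2 6)).
  apply: polymx_mul.
    apply: (mxclass_linear (@spin C : {linear _ -> _})) => //.
    apply: (mxclass_linear (@star C : {linear _ -> _})) => //.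
    by apply: (mxclass_linear (row 0 : {linear _ -> _})) => //; exact: polymx_frame.
  apply: (mxclass_linear (@spin C : {linear _ -> _})) => //.
  by apply: (mxclass_linear (row 1 : {linear _ -> _})) => //; exact: polymx_frame.
have [q qE] := PN k l.
(* At [v], row k of [N] is c y_k x and column l is c x_l y. Inverting these two constants, kept
   fixed while the argument of the lift varies, makes the lift return [w] exactly. *)
have a0 : (c * ypart w 0 k)^-1 != 0 by rewrite invr_neq0 // mulf_neq0.
have b0 : (c * xpart w 0 l)^-1 != 0 by rewrite invr_neq0 // mulf_neq0.
exists v, q, (fun v => coords ((c * ypart w 0 k)^-1 *: row k (N v))
                              ((c * xpart w 0 l)^-1 *: (col l (N v))^T)).
split=> //.
- by rewrite -qE NklE !mulf_neq0.
- rewrite -[RHS]coords_parts; congr coords; apply/rowP => j.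
    by rewrite mxE [row _ _ _ _]mxE NklE; field; rewrite c0 yk.
  by rewrite mxE [_^T _ _]mxE [col _ _ _ _]mxE NklE; field; rewrite c0 xl.
- have PL := @polyfun_linear_class C (ncoord (Gr C 2 6)).
  apply: mxclass_row_mx; apply: (mxclass_linear (mxvec : {linear _ -> _})) => //.
    apply: (mxclass_linear (_ \*: idfun : {linear _ -> _})) => //.
    exact: (mxclass_linear (row k : {linear _ -> _})).
  apply: (mxclass_linear (_ \*: idfun : {linear _ -> _})) => //.
  apply: (mxclass_linear (trmx : {linear _ -> _})) => //.
  exact: (mxclass_linear (col l : {linear _ -> _})).
- move=> [U' zU'] v' /= cv'; rewrite -qE => Nkl.
  have iso : isotropic_pair (row 0 (frame v')) (row 1 (frame v')).
    by apply/(section_s cv'); have [] := zU' _ cv'.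
  have [z' f' cz'] := flag_spinor cv' iso a0 b0 Nkl.
  by exists (exist _ z' ((flag_zero f').1 zU')).
Qed.

Lemma flag_lift_line : local_lift (fun y x => r x y).
Proof.
move=> [z m] [U zU] v /= f vU; have [w wz] := crep_point z.
have xy0 : (xpart w *m (ypart w)^T) 0 0 = 0 by rewrite FE; have [] := m w wz.
have [i [j pij]] := plucker_neq0 (crep_xpart wz) (crep_ypart wz) xy0.
have [U1 f1 cU1] := flag_plane wz xy0 (unitmx1 C 2) pij.
have UE := flag_uniq_plane wz f1 f; rewrite UE in cU1.
(* The change from the basis of two Pluecker rows to the given basis [v]; this constant matrix
   corrects the lift. *)
have [h hu hE] := crep_change cU1 vU.
pose B (w : 'rV[C]_(ncoord P)) := pairmx (row i (plucker (segre w))) (row j (plucker (segre w))).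
have PP : mxclass (@polyfun C _) (fun w => plucker (segre w)).
  apply: (mxclass_linear (@plucker C : {linear _ -> _})); first exact: polyfun_linear_class.
  exact: polymx_segre.
have [q qE] := PP i j.
exists w, q, (fun w => mxvec (h *m B w *m invmx K)); split=> //.
- by rewrite -qE.
- by move: hE; rewrite mxvecK mul1mx mulmxA => <-; rewrite vec_mxK.
- apply: (mxclass_linear (mxvec : {linear _ -> _})); first exact: polyfun_linear_class.
  apply: (mxclass_linear (mulmxr (invmx K) : {linear _ -> _})); first exact: polyfun_linear_class.
  apply: (mxclass_linear (mulmx h : {linear _ -> _})); first exact: polyfun_linear_class.
  move=> a b; rewrite (_ : (fun _ => _) = fun w => plucker (segre w) (if a == 0 then i else j) b).
    exact: PP.
  by apply/funext => w'; rewrite mxE; case: (a == 0); rewrite mxE.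
- move=> [z' m'] w' /= cw'; rewrite -qE => p'.
  have xy0' : (xpart w' *m (ypart w')^T) 0 0 = 0 by rewrite FE; have [] := m' w' cw'.
  have [U' f' cU'] := flag_plane cw' xy0' hu p'.
  by exists (exist _ U' ((flag_zero f').2 m')).
Qed.

Lemma flag_isomorphic : isomorphic X Y.
Proof.
apply: (@isomorphic_of_relation _ X Y r).
- exact: flag_point.
- exact: flag_line.
- move=> x y y' f f'; apply: sub_inj; have [w wz] := crep_point (sval y).
  by have [w' wz'] := crep_point (sval y'); exact: flag_uniq_point wz wz' f f'.
- move=> x x' y f f'; apply: sub_inj; have [w wz] := crep_point (sval y).
  exact: flag_uniq_plane wz f f'.
- exact: flag_lift_point.
- exact: flag_lift_line.
Qed.

(** * Transfer of the Jacobian criterion *)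

Lemma xpart_line (w w' : 'rV[C]_(ncoord P)) (a : C) : xpart (w + a *: w') = xpart w + a *: xpart w'.
Proof. by rewrite /xpart !linearD !linearZ. Qed.

Lemma ypart_line (w w' : 'rV[C]_(ncoord P)) (a : C) : ypart (w + a *: w') = ypart w + a *: ypart w'.
Proof. by rewrite /ypart !linearD !linearZ. Qed.

Lemma mdiff_F w w' : mdiff F w w' =
  (xpart w' *m (ypart w)^T) 0 0 + (xpart w *m (ypart w')^T) 0 0.
Proof.
pose g (u v : 'rV[C]_(ncoord P)) := (xpart u *m (ypart v)^T) 0 0.
rewrite (@mdiff_eq _ _ F w w' ((g w w)%:P + (g w' w + g w w')%:P * 'X + (g w' w')%:P * 'X^2)).
  by rewrite !coefD coefC coefMX coefC coefMXn add0r addr0.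
move=> a; rewrite -FE xpart_line ypart_line !hornerE linearD linearZ /=.
rewrite mulmxDl !mulmxDr -!scalemxAl -!scalemxAr /g.
move: (xpart w *m _) (xpart w *m _) (xpart w' *m _) (xpart w' *m _) => A1 A2 A3 A4.
by rewrite !mxE; ring.
Qed.

Lemma gform_line p0 p1 p2 : exists2 f : {poly C},
  forall a, gform (p0 + a *: p1 + a ^+ 2 *: p2) (p0 + a *: p1 + a ^+ 2 *: p2) = f.[a] &
  f`_1 = gform p0 p1 + gform p1 p0.
Proof.
exists ((gform p0 p0)%:P + (gform p0 p1 + gform p1 p0)%:P * 'X
  + ((gform p0 p2 + gform p2 p0 + gform p1 p1)%:P + (gform p1 p2 + gform p2 p1)%:P * 'X
     + (gform p2 p2)%:P * 'X^2) * 'X^2) => [a|].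
  by rewrite !gformDl !gformDr !gformZl !gformZr !hornerE /=; ring.
by rewrite !coefD coefC coefMX coefC coefMXn add0r addr0.
Qed.

Lemma segre_line (w w' : 'rV[C]_(ncoord P)) a : segre (w + a *: w') =
  segre w + a *: ((ypart w')^T *m xpart w + (ypart w)^T *m xpart w') + a ^+ 2 *: segre w'.
Proof.
have -> : segre (w + a *: w') = ((ypart w)^T + a *: (ypart w')^T) *m (xpart w + a *: xpart w').
  by rewrite /segre xpart_line ypart_line; congr (_ *m _); rewrite linearD linearZ.
rewrite mulmxDl !mulmxDr.
rewrite -!scalemxAl -!scalemxAr scalerDr scalerA -expr2 !addrA; congr (_ + _).
by rewrite -!addrA [X in _ + X]addrC.
Qed.

Lemma mdiff_G w w' :
  let p := plucker (segre w) in
  let p' := plucker ((ypart w')^T *m xpart w + (ypart w)^T *m xpart w') in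
  mdiff G w w' = gform p p' + gform p' p.
Proof.
move=> p p'; have [f fE <-] := gform_line p p' (plucker (segre w')).
apply: mdiff_eq => a; rewrite -GE -fE.
suff -> : plucker (segre (w + a *: w')) = p + a *: p' + a ^+ 2 *: plucker (segre w') by [].
by rewrite segre_line 2!raddfD /= !linearZ.
Qed.

Lemma chart_deriv_t I A B c : colsub I A = 1%:M -> colsub I B = 0 ->
  chart_deriv I t A B c ->
  let p := wedge (row 0 (A *m K)) (row 1 (A *m K)) in
  let p' := wedge (row 0 (B *m K)) (row 1 (A *m K)) + wedge (row 0 (A *m K)) (row 1 (B *m K)) in
  c = gform p p' + gform p' p.
Proof.
move=> AI BI tc p p'.
have [f fE <-] := gform_line p p' (wedge (row 0 (B *m K)) (row 1 (B *m K))).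
apply: (chart_deriv_eq AI BI tc) => a.
rewrite section_row_free ?(chart_line_row_free _ AI BI) // -fE.
have -> : wedge (row 0 ((A + a *: B) *m K)) (row 1 ((A + a *: B) *m K)) =
    p + a *: p' + a ^+ 2 *: wedge (row 0 (B *m K)) (row 1 (B *m K)); last by [].
have rE i : row i ((A + a *: B) *m K) = row i (A *m K) + a *: row i (B *m K).
  by rewrite mulmxDl -scalemxAl linearD linearZ.
by rewrite !rE wedge_line.
Qed.

Hypothesis smooth : smooth_zero_scheme s t.

(** A tangent direction B of Gr(2, 6) along s = 0 that moves t becomes, by [spinor_tangent], a
    direction (x', y') along F = 0; the derivatives of t and G then agree up to a nonzero factor. *)
Lemma flag_smooth : smooth_intersection F G.
Proof.
move=> z w m wz c d; have x0 := crep_xpart wz; have y0 := crep_ypart wz.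
have mD (w1 w2 : 'rV_(ncoord P)) a b (p : {mpoly C[ncoord P]}) :
    mdiff p w (a *: w1 + b *: w2) = a * mdiff p w w1 + b * mdiff p w w2.
  rewrite !mulr_sumr -big_split; apply: eq_bigr => i _ /=; rewrite !mxE; ring.
(* One such direction suffices: changing y alone, at a coordinate where x is nonzero, already gives
   dF the value 1. *)
suff [w1 F1 G1] : exists2 w1, mdiff F w w1 = 0 & mdiff G w w1 != 0.
  have /rV0Pn[k xk] := x0.
  pose w2 := coords 0 ((xpart w 0 k)^-1 *: delta_mx 0 k).
  have F2 : mdiff F w w2 = 1.
    rewrite mdiff_F xpart_coords ypart_coords mul0mx linearZ /= -scalemxAr trmx_delta -colE.
    by rewrite [X in X + _]mxE add0r mxE [col _ _ _ _]mxE mulVf.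
  exists (c *: w2 + ((d - c * mdiff G w w2) / mdiff G w w1) *: w1).
  rewrite !mD F1 F2 mulr0 mulr1 addr0; split=> //.
  by rewrite divfK // addrC subrK.
have [[U zU] /= f] := flag_line (exist _ z m).
have [A0 AU fA0] := crep_rep U; have [h [I [hu AI]]] := chart_exists fA0.
set A := h *m A0 in AI; have AU' : @crep C (Gr C 2 6) (mxvec A) U.
  by have := crep_mull AU hu; rewrite mxvecK.
have [sA tA] := zU _ AU'; rewrite mxvecK in sA tA.
(* Prescribed derivatives: 0 for s and 1 for t. *)
have [B [BI sB tB]] := smooth AI sA tA 1 (trmx0 C 2 2).
have sE : A *m Q *m B^T + B *m Q *m A^T = 0.
  have S0 : forall i j, chart_deriv I (fun A => s A i j) A B ((0 : 'M_2) i j) by exact: sB.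
  by have /esym := S2_chart_deriv sQ AI BI S0.
have [_ _ [e e0 [_ wE]]] := flagP f AU' wz; rewrite /frame mxvecK in wE.
have iA := f _ _ AU' wz; rewrite /frame mxvecK in iA.
have uv := frame_wedge AU'; rewrite /frame mxvecK in uv.
have bE i j : bil (row i (A *m K)) (row j (B *m K)) + bil (row i (B *m K)) (row j (A *m K)) = 0.
  have qE (M N : 'M[C]_(2, 6)) : (M *m Q *m N^T) i j = bil (row i (M *m K)) (row j (N *m K)).
    rewrite !row_mul -QK /qform !mxE; apply: eq_bigr => l _; rewrite !mxE; congr (_ * _).
    by apply: eq_bigr => l' _; rewrite !mxE.
  by rewrite -!qE; move/matrixP/(_ i j): sE; rewrite !mxE.
have b2 i : bil (row i (A *m K)) (row i (B *m K)) = 0.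
  have /eqP := bE i i; rewrite (bilC (row i (B *m K))) -mulr2n mulrn_eq0 => /eqP //.
have [x' [y' [xy pE]]] := spinor_tangent x0 y0 uv (iA 0) (iA 1) (b2 0) (b2 1) (etrans (addrC _ _) (bE 0 1)).
exists (coords x' y'); first by rewrite mdiff_F xpart_coords ypart_coords.
rewrite mdiff_G xpart_coords ypart_coords pE.
have := chart_deriv_t AI BI tB; rewrite /= wE gformZl gformZr -mulrDr => E.
by apply: contra_eq_neq E => ->; rewrite mulr0 oner_eq0.
Qed.

End Geometry.

Theorem proposition2p1 (R : realType)
    (s : 'M[R[i]]_(2, 6) -> 'M[R[i]]_2) (t : 'M[R[i]]_(2, 6) -> R[i])
    (Xb4 : smooth_kuchle_b4 s t) :
  exists F G : {mpoly R[i][ncoord (P3xP3 R[i])]},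
    [/\ bidegree 1 1 F, bidegree 2 2 G, smooth_intersection F G &
        isomorphic (sub (zero_locus s t)) (sub (divisors_meet F G))].
Proof.
case: Xb4 => sS tO sm [[X0] _] _.
have [Q QT sQ] := @S2_section_form _ 6 isT s sS.
have [T _ tT] := @O_section_form _ 6 isT t tO.
have Qu := @smooth_nondegenerate _ 6 Q s t isT QT sQ tO sm.
have [K Ku QK] := hyperbolic_basis QT Qu.
have [F Fb FE] := bipoly_pairing R[i].
have [G Gb GE] := bipoly_wedge_form (pull K \o @plucker R[i]) T.
have smFG := flag_smooth Ku QK sQ tO tT FE GE sm.
exists F, G; split=> //; last exact: (flag_isomorphic Ku QK sQ tO tT FE GE).
(* At the point of the intersection corresponding to [X0], smoothness gives dF the value 1, which
   the zero polynomial could not have; the argument for G is the same. *)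
- split=> //; have [[z m] _] := flag_point Ku QK sQ tO tT FE GE X0.
  have [w wz] := crep_point z; have [w' [E _]] := smFG z w m wz 1 0.
  by apply/eqP => F0; move/eqP: E; rewrite F0 mdiff0 eq_sym oner_eq0.
- split=> //; have [[z m] _] := flag_point Ku QK sQ tO tT FE GE X0.
  have [w wz] := crep_point z; have [w' [_ E]] := smFG z w m wz 0 1.
  by apply/eqP => G0; move/eqP: E; rewrite G0 mdiff0 eq_sym oner_eq0.
Qed.
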